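(* There do not exist a nonempty open set $U\subsetneq\mathbb{R}^2$, a smooth function $u:U\to\mathbb{R}$ with $\mathrm{Hess}(u)$ positive definite and $\det \mathrm{Hess}(u)=1$ everywhere on $U$, and a point $x\in U$ such that $$\sqrt{R(x)}=\frac{3}{\mathrm{dist}_{g|_x}(x,\partial U)},$$ where $g$ is the Hessian metric $g|_p=\mathrm{Hess}(u)|_p$ on $U$ and $R$ is its scalar curvature. (That is, no example realizes equality in the estimate $\sqrt{R(x)}\leq 3/\mathrm{dist}_{g|_x}(x,\partial U)$.)
   Context: $\mathrm{dist}_{g|_x}(x,\partial U)$ denotes the distance from $x$ to $\partial U\subset\mathbb{R}^2$ measured with the constant inner product $g|_x=\mathrm{Hess}(u)|_x$ on $\mathbb{R}^2$, i.e. $\inf_{p\in\partial U}\sqrt{(p-x)^\top \mathrm{Hess}(u)|_x\,(p-x)}$. The scalar curvature is the trace of the Ricci tensor, i.e. twice the Gaussian curvature. For $2\times2$ matrices, $\mathrm{Sp}(2,\mathbb{R})=\mathrm{SL}(2,\mathbb{R})$. *)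

(* Defs.v *)
From Stdlib Require Import Reals.
From Coquelicot Require Import Coquelicot.
Open Scope R_scope.

Inductive idx : Set := i1 | i2.

Definition sum2 (f : idx -> R) : R := f i1 + f i2.

Definition coord (p : R * R) (i : idx) : R :=
  match i with i1 => fst p | i2 => snd p end.

(* Functions on an open set [U] are represented by total functions on the plane;
   all the notions below, taken at a point of [U], only depend on the
   restriction to [U]. *)
Definition partial (i : idx) (f : R * R -> R) (p : R * R) : R :=
  match i with
  | i1 => Derive (fun t => f (t, snd p)) (fst p)
  | i2 => Derive (fun t => f (fst p, t)) (snd p)
  end.

(* [ex_diff_n f n x y]: all iterated partial derivatives of [f] of order at most
   [n] exist and are (jointly) continuous at [(x, y)]. *)
Definition smooth_on (U : R * R -> Prop) (f : R * R -> R) : Prop :=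
  forall (p : R * R) (n : nat), U p ->
    ex_diff_n (fun a b => f (a, b)) n (fst p) (snd p).

Definition det2 (M : idx -> idx -> R) : R :=
  M i1 i1 * M i2 i2 - M i1 i2 * M i2 i1.

Definition inv2 (M : idx -> idx -> R) (i j : idx) : R :=
  match i, j with
  | i1, i1 => M i2 i2 / det2 M
  | i1, i2 => - M i1 i2 / det2 M
  | i2, i1 => - M i2 i1 / det2 M
  | i2, i2 => M i1 i1 / det2 M
  end.

Definition quad_form (M : idx -> idx -> R) (v : idx -> R) : R :=
  sum2 (fun i => sum2 (fun j => v i * M i j * v j)).

Definition pos_def (M : idx -> idx -> R) : Prop :=
  (forall i j, M i j = M j i) /\
  (forall v : idx -> R, (exists i, v i <> 0) -> 0 < quad_form M v).

Definition Hess (u : R * R -> R) (p : R * R) (i j : idx) : R :=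
  partial i (partial j u) p.

(* A metric on a planar domain, by its coefficients [g p i j]. *)
Definition metric := R * R -> idx -> idx -> R.

(* Gamma^k_{ij} *)
Definition christoffel (g : metric) (k i j : idx) (p : R * R) : R :=
  / 2 * sum2 (fun l => inv2 (g p) k l *
    (partial i (fun q => g q j l) p + partial j (fun q => g q i l) p
     - partial l (fun q => g q i j) p)).

(* The coefficient of d_l in
   (nabla_i nabla_j - nabla_j nabla_i) d_k. *)
Definition riemann (g : metric) (l k i j : idx) (p : R * R) : R :=
  partial i (christoffel g l j k) p - partial j (christoffel g l i k) p
  + sum2 (fun m => christoffel g l i m p * christoffel g m j k p)
  - sum2 (fun m => christoffel g l j m p * christoffel g m i k p).

(* Ric(Y, Z) is the trace of X |-> Rm(X, Y) Z, so that round spheres have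
   positive curvature. *)
Definition ricci (g : metric) (j k : idx) (p : R * R) : R :=
  sum2 (fun i => riemann g i k i j p).

Definition scalar_curvature (g : metric) (p : R * R) : R :=
  sum2 (fun j => sum2 (fun k => inv2 (g p) j k * ricci g j k p)).

(* [~ locally p (fun q => ~ U q)] says that [p] is in the closure of [U]. *)
Definition boundary (U : R * R -> Prop) (p : R * R) : Prop :=
  ~ locally p (fun q => ~ U q) /\ ~ locally p U.

(* Distance from [x] to [S] for the constant inner product [G]; [Glb_Rbar] is
   the infimum in the extended reals, finite as soon as [S] is nonempty. *)
Definition dist_to (G : idx -> idx -> R) (x : R * R) (S : R * R -> Prop) : R :=
  real (Glb_Rbar (fun d => exists p : R * R, S p /\
    d = sqrt (quad_form G (fun i => coord p i - coord x i)))).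

(* Main.v *)
Require Import Defs.
From Stdlib Require Import Reals Lra Classical ClassicalEpsilon List.
From Coquelicot Require Import Coquelicot.
Open Scope R_scope.

(** Why equality is impossible.  An affine change of variables of determinant 1
turns the Hessian at the given point into the identity and the point into 0;
the distance to the boundary becomes the Euclidean radius [d] of a disc on
which [u] is defined.  On that disc put, for z in the complex plane and with
the gradient measured from its value at 0,

      zeta = z + grad u (z),      F = conj (z - grad u (z)).

The equation det Hess(u) = 1 is the Cauchy-Riemann equation dF = H dzeta, and
convexity gives |H| < 1.  Thus F is a holomorphic function of zeta whose
derivative H vanishes at 0, and R = 16 |F''(0)|^2 at 0.  Since u is convex,
zeta is expanding, so it is a chart.

Suppose that zeta covers the disc of radius rho.  The Schwarz lemma gives
|H| <= |zeta| / rho, so |F| <= |zeta|^2 / (2 rho), and z = (zeta + conj F) / 2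
has modulus at most 3 rho / 4.  Taking for rho the least value of |zeta| on the
circle |z| = r gives rho >= 4 r / 3 ([lewy_onto], [lewy_circle]).  Letting r
tend to [d], zeta covers the disc of radius rho = 4 d / 3, and the Schwarz
lemma at 0 is the estimate sqrt R = 4 |F''(0)| <= 4 / rho = 3 / d.

In the case of equality the Schwarz lemma is an equality at 0, so H = k zeta
with |k| = 1 / rho ([Schwarz_rigidity]) and z = (zeta + conj (k zeta^2 / 2)) / 2.
The circle |zeta| = rho is then sent to a deltoid that meets |z| = d only at
its three cusps.  Along a radius that avoids the cusps, z tends to a point with
|z| < d while |H| tends to 1; by continuity |H| = 1 at that point, which
contradicts |H| < 1 ([normalised_not_extremal]).

The function theory rests on the maximum principle alone: the singularity of
H / zeta at 0 is absorbed by a small multiple of log |zeta|, and rigidity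
follows from the Schwarz inequality by the argument of Borel and
Caratheodory. *)

(** * Differential calculus of complex-valued functions on the plane *)

Definition little_o (z : C) (phi : C -> C) : Prop :=
  forall eps, 0 < eps -> exists delta, 0 < delta /\
    forall w, Cmod (w - z) < delta -> Cmod (phi w) <= eps * Cmod (w - z).

(** Real differentiability of a map from the plane to the plane, with both
partial derivatives written as complex numbers.  Holomorphy is the case
[b = Ci * a], so a single product rule and a single quotient rule serve the
plane of z, where functions are only smooth, and the plane of zeta. *)
Definition has_partials (f : C -> C) (z a b : C) : Prop :=
  little_o z (fun w => f w - f z - (a * RtoC (Re (w - z)) + b * RtoC (Im (w - z))))%C.

Definition has_cderiv (f : C -> C) (z l : C) : Prop :=
  has_partials f z l (Ci * l)%C.

Lemma Cmod_sub_sym (z w : C) : Cmod (z - w) = Cmod (w - z).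
Proof. rewrite <- Cmod_opp; f_equal; ring. Qed.

Lemma Cmod_sub_triangle (z w : C) : Cmod z <= Cmod w + Cmod (z - w).
Proof.
replace z with (w + (z - w))%C at 1 by ring. apply Cmod_triangle.
Qed.

Lemma im_le_Cmod (c : C) : Rabs (Im c) <= Cmod c.
Proof. exact (Rle_trans _ _ _ (Rmax_r _ _) (Rmax_Cmod c)). Qed.

Lemma little_o_ext z phi psi :
  (exists delta, 0 < delta /\ forall w, Cmod (w - z) < delta -> phi w = psi w) ->
  little_o z phi -> little_o z psi.
Proof.
intros [d1 [Hd1 H1]] H eps Heps. destruct (H eps Heps) as [d2 [Hd2 H2]].
exists (Rmin d1 d2). split; [now apply Rmin_glb_lt|].
intros w Hw. rewrite <- H1; [apply H2|]; eapply Rlt_le_trans; eauto using Rmin_l, Rmin_r.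
Qed.

Lemma little_o_plus z phi psi :
  little_o z phi -> little_o z psi -> little_o z (fun w => phi w + psi w)%C.
Proof.
intros H1 H2 eps Heps.
destruct (H1 (eps / 2)) as [d1 [Hd1 K1]]; [lra|].
destruct (H2 (eps / 2)) as [d2 [Hd2 K2]]; [lra|].
exists (Rmin d1 d2). split; [now apply Rmin_glb_lt|]. intros w Hw.
assert (A1 := K1 w (Rlt_le_trans _ _ _ Hw (Rmin_l _ _))).
assert (A2 := K2 w (Rlt_le_trans _ _ _ Hw (Rmin_r _ _))).
eapply Rle_trans; [apply Cmod_triangle|]. lra.
Qed.

Lemma little_o_mult_bounded z g phi M :
  (exists delta, 0 < delta /\ forall w, Cmod (w - z) < delta -> Cmod (g w) <= M) ->
  little_o z phi -> little_o z (fun w => g w * phi w)%C.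
Proof.
intros [d1 [Hd1 K1]] H eps Heps.
assert (HM : 0 <= M).
{ eapply Rle_trans; [apply Cmod_ge_0|apply (K1 z)].
  replace (z - z)%C with (RtoC 0) by ring. now rewrite Cmod_0. }
destruct (H (eps / (M + 1))) as [d2 [Hd2 K2]]; [apply Rdiv_lt_0_compat; lra|].
exists (Rmin d1 d2). split; [now apply Rmin_glb_lt|]. intros w Hw.
assert (A1 := K1 w (Rlt_le_trans _ _ _ Hw (Rmin_l _ _))).
assert (A2 := K2 w (Rlt_le_trans _ _ _ Hw (Rmin_r _ _))).
rewrite Cmod_mult.
apply Rle_trans with ((M + 1) * (eps / (M + 1) * Cmod (w - z))).
- apply Rmult_le_compat; try apply Cmod_ge_0; lra.
- right. field. lra.
Qed.

Lemma little_o_scal z c phi : little_o z phi -> little_o z (fun w => c * phi w)%C.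
Proof.
apply little_o_mult_bounded with (Cmod c). exists 1. split; [lra|]. intros; lra.
Qed.

Lemma little_o_ext_all z phi psi :
  (forall w, phi w = psi w) -> little_o z phi -> little_o z psi.
Proof. intros H. apply little_o_ext. exists 1. split; [lra|auto]. Qed.

Definition locally_Lipschitz_at (f : C -> C) (z : C) : Prop :=
  exists M delta, 0 < M /\ 0 < delta /\
    forall w, Cmod (w - z) < delta -> Cmod (f w - f z) <= M * Cmod (w - z).

Lemma has_partials_Lipschitz f z a b :
  has_partials f z a b -> locally_Lipschitz_at f z.
Proof.
intros H. destruct (H 1 Rlt_0_1) as [d [Hd K]].
exists (1 + Cmod a + Cmod b), d.
assert (Ha := Cmod_ge_0 a). assert (Hb := Cmod_ge_0 b).
split; [lra|split; [exact Hd|]]. intros w Hw. specialize (K w Hw). cbv beta in K.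
set (h := (w - z)%C) in *.
replace (f w - f z)%C with
  ((f w - f z - (a * RtoC (Re h) + b * RtoC (Im h))) + (a * RtoC (Re h) + b * RtoC (Im h)))%C by ring.
eapply Rle_trans; [apply Cmod_triangle|].
assert (A : Cmod (a * RtoC (Re h) + b * RtoC (Im h)) <= (Cmod a + Cmod b) * Cmod h).
{ eapply Rle_trans; [apply Cmod_triangle|]. rewrite !Cmod_mult, !Cmod_R.
  assert (A1 := Rmult_le_compat_l _ _ _ Ha (re_le_Cmod h)).
  assert (A2 := Rmult_le_compat_l _ _ _ Hb (im_le_Cmod h)). lra. }
lra.
Qed.

Lemma little_o_mult_Lipschitz z f g :
  locally_Lipschitz_at f z -> locally_Lipschitz_at g z ->
  little_o z (fun w => (f w - f z) * (g w - g z))%C.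
Proof.
intros [M1 [d1 [HM1 [Hd1 K1]]]] [M2 [d2 [HM2 [Hd2 K2]]]] eps Heps.
set (d3 := eps / (M1 * M2)).
assert (HM : 0 < M1 * M2) by nra.
assert (Hd3 : 0 < d3) by (apply Rdiv_lt_0_compat; lra).
exists (Rmin (Rmin d1 d2) d3). split; [repeat apply Rmin_glb_lt; assumption|]. intros w Hw.
assert (A3 : Cmod (w - z) < d3) by (eapply Rlt_le_trans; [exact Hw|apply Rmin_r]).
assert (A : Cmod (w - z) < Rmin d1 d2) by (eapply Rlt_le_trans; [exact Hw|apply Rmin_l]).
specialize (K1 w (Rlt_le_trans _ _ _ A (Rmin_l _ _))).
specialize (K2 w (Rlt_le_trans _ _ _ A (Rmin_r _ _))).
rewrite Cmod_mult.
assert (H0 := Cmod_ge_0 (w - z)).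
apply Rle_trans with ((M1 * Cmod (w - z)) * (M2 * Cmod (w - z))).
- apply Rmult_le_compat; try apply Cmod_ge_0; assumption.
- replace (M1 * Cmod (w - z) * (M2 * Cmod (w - z))) with (M1 * M2 * Cmod (w-z) * Cmod (w-z)) by ring.
  apply Rmult_le_compat_r; [exact H0|].
  apply Rle_trans with (M1 * M2 * d3); [apply Rmult_le_compat_l; lra|].
  right. unfold d3. field. lra.
Qed.

Lemma has_partials_ext_loc f g z a b :
  (exists delta, 0 < delta /\ forall w, Cmod (w - z) < delta -> f w = g w) ->
  has_partials f z a b -> has_partials g z a b.
Proof.
intros [d [Hd K]]. apply little_o_ext. exists d. split; [exact Hd|].
intros w Hw. rewrite (K w Hw), (K z); [reflexivity|].
replace (z - z)%C with (RtoC 0) by ring. now rewrite Cmod_0.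
Qed.

Lemma has_partials_ext f g z a b :
  (forall w, f w = g w) -> has_partials f z a b -> has_partials g z a b.
Proof. intros H. apply has_partials_ext_loc. exists 1. split; [lra|auto]. Qed.

Lemma has_partials_const c z : has_partials (fun _ => c) z 0%C 0%C.
Proof.
intros eps Heps. exists 1. split; [lra|]. intros w _.
match goal with |- Cmod ?e <= _ => replace e with (RtoC 0) by ring end.
rewrite Cmod_0. assert (H := Cmod_ge_0 (w - z)). nra.
Qed.

Lemma has_partials_plus f g z a b a' b' :
  has_partials f z a b -> has_partials g z a' b' ->
  has_partials (fun w => f w + g w)%C z (a + a')%C (b + b')%C.
Proof.
intros Hf Hg. refine (little_o_ext_all _ _ _ _ (little_o_plus _ _ _ Hf Hg)).
intros w. simpl. ring.
Qed.

Lemma has_partials_mult f g z a b a' b' :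
  has_partials f z a b -> has_partials g z a' b' ->
  has_partials (fun w => f w * g w)%C z (a * g z + f z * a')%C (b * g z + f z * b')%C.
Proof.
intros Hf Hg.
refine (little_o_ext_all _ _ _ _ (little_o_plus _ _ _ (little_o_plus _ _ _
  (little_o_scal _ (g z) _ Hf) (little_o_scal _ (f z) _ Hg))
  (little_o_mult_Lipschitz z f g (has_partials_Lipschitz _ _ _ _ Hf) (has_partials_Lipschitz _ _ _ _ Hg)))).
intros w. simpl. ring.
Qed.

Lemma has_partials_scal c f z a b :
  has_partials f z a b -> has_partials (fun w => c * f w)%C z (c * a)%C (c * b)%C.
Proof.
intros Hf. assert (H := has_partials_mult _ _ _ _ _ _ _ (has_partials_const c z) Hf).
rewrite !Cmult_0_l, !Cplus_0_l in H. exact H.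
Qed.

Lemma has_partials_inv f z a b :
  has_partials f z a b -> f z <> 0%C ->
  has_partials (fun w => / f w)%C z (- a / (f z * f z))%C (- b / (f z * f z))%C.
Proof.
intros Hf Hz.
assert (HL := has_partials_Lipschitz _ _ _ _ Hf).
assert (P := proj1 (Cmod_gt_0 _) Hz).
assert (HB : exists delta, 0 < delta /\ forall w, Cmod (w - z) < delta -> Cmod (f z) / 2 < Cmod (f w)).
{ destruct HL as [M [d [HM [Hd K]]]].
  exists (Rmin d (Cmod (f z) / 2 / M)).
  assert (0 < Cmod (f z) / 2 / M) by (apply Rdiv_lt_0_compat; lra).
  split; [now apply Rmin_glb_lt|]. intros w Hw.
  assert (A1 := Rlt_le_trans _ _ _ Hw (Rmin_l _ _)).
  assert (A2 := Rlt_le_trans _ _ _ Hw (Rmin_r _ _)).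
  specialize (K w A1).
  assert (B := Cmod_sub_triangle (f z) (f w)). rewrite Cmod_sub_sym in B.
  assert (M * Cmod (w - z) < Cmod (f z) / 2).
  { apply Rlt_le_trans with (M * (Cmod (f z) / 2 / M)); [now apply Rmult_lt_compat_l|].
    right. field. lra. }
  lra. }
destruct HB as [d [Hd K]].
assert (HB : exists delta, 0 < delta /\
   forall w, Cmod (w - z) < delta -> Cmod (/ (f w * (f z * f z))) <= / (Cmod (f z) / 2 * (Cmod (f z) * Cmod (f z)))).
{ exists d. split; [exact Hd|]. intros w Hw. specialize (K w Hw).
  assert (f w <> 0%C) by (apply Cmod_gt_0; lra).
  rewrite Cmod_inv by now repeat apply Cmult_neq_0.
  assert (0 < Cmod (f z) * Cmod (f z)) by now apply Rmult_lt_0_compat.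
  rewrite !Cmod_mult. apply Rinv_le_contravar.
  - apply Rmult_lt_0_compat; lra.
  - apply Rmult_le_compat_r; lra. }
refine (little_o_ext _ _ _ _ (little_o_plus _ _ _ (little_o_scal _ (- / (f z * f z))%C _ Hf)
  (little_o_mult_bounded _ _ _ _ HB (little_o_mult_Lipschitz z f f HL HL)))).
exists d. split; [exact Hd|]. intros w Hw. specialize (K w Hw).
assert (f w <> 0%C) by (apply Cmod_gt_0; lra).
simpl. field. split; assumption.
Qed.

Lemma has_partials_div f g z a b a' b' :
  has_partials f z a b -> has_partials g z a' b' -> g z <> 0%C ->
  has_partials (fun w => f w / g w)%C z ((a - f z / g z * a') / g z)%C ((b - f z / g z * b') / g z)%C.
Proof.
intros Hf Hg Hz.
assert (H := has_partials_mult _ _ _ _ _ _ _ Hf (has_partials_inv _ _ _ _ Hg Hz)).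
match type of H with has_partials _ _ ?u ?v =>
  match goal with |- has_partials _ _ ?u' ?v' =>
    replace u' with u by (field; assumption); replace v' with v by (field; assumption) end end.
exact H.
Qed.

(** This is what allows an identity that holds on an open set to be
differentiated: both sides have the same partial derivatives. *)
Lemma has_partials_unique f z a b a' b' :
  has_partials f z a b -> has_partials f z a' b' -> a = a' /\ b = b'.
Proof.
assert (Key : forall c d : C, (forall eps, 0 < eps -> Cmod (c - d) <= eps) -> c = d).
{ intros c d H. replace c with ((c - d) + d)%C by ring. rewrite (Cmod_eq_0 (c - d)); [ring|].
  apply Rle_antisym; [|apply Cmod_ge_0]. apply le_epsilon. intros eps Heps.
  rewrite Rplus_0_l. auto. }
intros H1 H2.
assert (H := little_o_plus _ _ _ H2 (little_o_scal _ (- (1))%C _ H1)). cbv beta in H.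
split; apply Key; intros eps Heps; destruct (H eps Heps) as [d [Hd K]].
- specialize (K (z + RtoC (d / 2))%C).
  replace (z + RtoC (d / 2) - z)%C with (RtoC (d / 2)) in K by ring.
  rewrite Cmod_R, Rabs_pos_eq in K by lra. specialize (K ltac:(lra)).
  match type of K with Cmod ?e <= _ =>
    replace e with ((a - a') * RtoC (d / 2))%C in K by (simpl; ring) end.
  rewrite Cmod_mult, Cmod_R, Rabs_pos_eq in K by lra. nra.
- specialize (K (z + Ci * RtoC (d / 2))%C).
  replace (z + Ci * RtoC (d / 2) - z)%C with (Ci * RtoC (d / 2))%C in K by ring.
  rewrite Cmod_mult, Cmod_Ci, Cmod_R, Rabs_pos_eq in K by lra. specialize (K ltac:(lra)).
  replace (Re (Ci * RtoC (d / 2))) with 0 in K by (simpl; ring).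
  replace (Im (Ci * RtoC (d / 2))) with (d / 2) in K by (simpl; ring).
  match type of K with Cmod ?e <= _ =>
    replace e with ((b - b') * RtoC (d / 2))%C in K by ring end.
  rewrite Cmod_mult, Cmod_R, Rabs_pos_eq in K by lra. nra.
Qed.

Lemma has_partials_line f z v t a b :
  has_partials f (z + RtoC t * v)%C a b ->
  is_derive (fun s => Re (f (z + RtoC s * v)%C)) t
    (Re (a * RtoC (Re v) + b * RtoC (Im v))%C).
Proof.
intros H. apply is_derive_Reals. intros eps Heps.
assert (Hv := Cmod_ge_0 v).
destruct (H (eps / 2 / (Cmod v + 1))) as [d [Hd K]].
{ repeat apply Rdiv_lt_0_compat; lra. }
assert (Hd' : 0 < d / (Cmod v + 1)) by (apply Rdiv_lt_0_compat; lra).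
exists (mkposreal _ Hd'). intros h Hh Hlt. simpl in Hlt.
specialize (K (z + RtoC (t + h) * v)%C).
replace (z + RtoC (t + h) * v - (z + RtoC t * v))%C with (RtoC h * v)%C in K
  by (rewrite RtoC_plus; ring).
rewrite Cmod_mult, Cmod_R in K.
assert (Hp : 0 < Rabs h) by now apply Rabs_pos_lt.
assert (A : Rabs h * Cmod v < d).
{ apply Rle_lt_trans with (Rabs h * (Cmod v + 1)); [nra|].
  apply Rlt_le_trans with (d / (Cmod v + 1) * (Cmod v + 1)); [nra|]. right; field; lra. }
specialize (K A).
assert (B := Rle_trans _ _ _ (re_le_Cmod _) K).
match goal with |- Rabs ?e < _ =>
  match type of B with Rabs ?e' <= _ => replace e with (e' / h) end end.
2:{ rewrite !re_scal_l, !im_scal_l.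
    unfold Re, Im; simpl. field. exact Hh. }
unfold Rdiv at 1. rewrite Rabs_mult, Rabs_inv.
apply Rle_lt_trans with (eps / 2 / (Cmod v + 1) * (Rabs h * Cmod v) * / Rabs h).
- apply Rmult_le_compat_r; [left; now apply Rinv_0_lt_compat|exact B].
- replace (eps / 2 / (Cmod v + 1) * (Rabs h * Cmod v) * / Rabs h) with
    (eps / 2 * (Cmod v / (Cmod v + 1))) by (field; lra).
  assert (Cmod v / (Cmod v + 1) <= 1).
  { apply Rle_div_l; lra. }
  nra.
Qed.

Lemma has_partials_Re z : has_partials (fun w => RtoC (Re w)) z 1%C 0%C.
Proof.
intros eps Heps. exists 1. split; [lra|]. intros w _.
match goal with |- Cmod ?e <= _ => replace e with (RtoC 0) end.
- rewrite Cmod_0. apply Rmult_le_pos; [lra|apply Cmod_ge_0].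
- apply injective_projections; unfold Re, Im; simpl; ring.
Qed.

Lemma has_partials_Im z : has_partials (fun w => RtoC (Im w)) z 0%C 1%C.
Proof.
intros eps Heps. exists 1. split; [lra|]. intros w _.
match goal with |- Cmod ?e <= _ => replace e with (RtoC 0) end.
- rewrite Cmod_0. apply Rmult_le_pos; [lra|apply Cmod_ge_0].
- apply injective_projections; unfold Re, Im; simpl; ring.
Qed.

Lemma has_partials_pair f1 f2 z a1 b1 a2 b2 :
  has_partials (fun w => RtoC (f1 w)) z (RtoC a1) (RtoC b1) ->
  has_partials (fun w => RtoC (f2 w)) z (RtoC a2) (RtoC b2) ->
  has_partials (fun w => ((f1 w, f2 w) : C)) z ((a1, a2) : C) ((b1, b2) : C).
Proof.
intros H1 H2.
assert (H := has_partials_plus _ _ _ _ _ _ _ H1 (has_partials_scal Ci _ _ _ _ H2)).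
assert (E : forall x y : R, (RtoC x + Ci * RtoC y)%C = ((x, y) : C)).
{ intros x y. apply injective_projections; simpl; ring. }
rewrite !E in H. refine (has_partials_ext _ _ _ _ _ _ H). intros w. apply E.
Qed.

Lemma has_partials_affine f z a b c s :
  has_partials (fun w => RtoC (f w)) z (RtoC a) (RtoC b) ->
  has_partials (fun w => RtoC (c + s * f w)) z (RtoC (s * a)) (RtoC (s * b)).
Proof.
intros H.
assert (H' := has_partials_plus _ _ _ _ _ _ _ (has_partials_const (RtoC c) z) (has_partials_scal (RtoC s) _ _ _ _ H)).
rewrite !Cplus_0_l in H'. rewrite !RtoC_mult.
refine (has_partials_ext _ _ _ _ _ _ H'). intros w. now rewrite RtoC_plus, RtoC_mult.
Qed.

Lemma has_partials_affine_pair f1 f2 z a1 b1 a2 b2 c1 s1 c2 s2 :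
  has_partials (fun w => RtoC (f1 w)) z (RtoC a1) (RtoC b1) ->
  has_partials (fun w => RtoC (f2 w)) z (RtoC a2) (RtoC b2) ->
  has_partials (fun w => ((c1 + s1 * f1 w, c2 + s2 * f2 w) : C)) z
    ((s1 * a1, s2 * a2) : C) ((s1 * b1, s2 * b2) : C).
Proof.
intros H1 H2. apply has_partials_pair; now apply has_partials_affine.
Qed.

Lemma has_cderiv_div f g z l l' :
  has_cderiv f z l -> has_cderiv g z l' -> g z <> 0%C ->
  has_cderiv (fun w => f w / g w)%C z ((l - f z / g z * l') / g z)%C.
Proof.
intros Hf Hg Hz. assert (H := has_partials_div _ _ _ _ _ _ _ Hf Hg Hz).
unfold has_cderiv. match goal with |- has_partials _ _ _ ?v' =>
  match type of H with has_partials _ _ _ ?v =>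
  replace v' with v by (field; assumption) end end.
exact H.
Qed.

Lemma has_cderiv_id z : has_cderiv (fun w => w) z 1%C.
Proof.
intros eps Heps. exists 1. split; [lra|]. intros w _.
match goal with |- Cmod ?e <= _ => replace e with (RtoC 0) end.
- rewrite Cmod_0. apply Rmult_le_pos; [lra|apply Cmod_ge_0].
- apply injective_projections; unfold Re, Im; simpl; ring.
Qed.

Lemma has_cderiv_plus f g z l l' :
  has_cderiv f z l -> has_cderiv g z l' -> has_cderiv (fun w => f w + g w)%C z (l + l')%C.
Proof.
intros Hf Hg. unfold has_cderiv. rewrite Cmult_plus_distr_l.
exact (has_partials_plus _ _ _ _ _ _ _ Hf Hg).
Qed.

Lemma has_cderiv_mult f g z l l' :
  has_cderiv f z l -> has_cderiv g z l' ->
  has_cderiv (fun w => f w * g w)%C z (l * g z + f z * l')%C.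
Proof.
intros Hf Hg. unfold has_cderiv.
replace (Ci * (l * g z + f z * l'))%C with (Ci * l * g z + f z * (Ci * l'))%C by ring.
exact (has_partials_mult _ _ _ _ _ _ _ Hf Hg).
Qed.

Lemma has_cderiv_const c z : has_cderiv (fun _ => c) z 0%C.
Proof. unfold has_cderiv. rewrite Cmult_0_r. apply has_partials_const. Qed.

Lemma has_cderiv_scal c f z l : has_cderiv f z l -> has_cderiv (fun w => c * f w)%C z (c * l)%C.
Proof.
intros H. replace (c * l)%C with (0 * f z + c * l)%C by ring.
exact (has_cderiv_mult _ _ _ _ _ (has_cderiv_const c z) H).
Qed.

Lemma has_cderiv_line f z v t l :
  has_cderiv f (z + RtoC t * v)%C l ->
  is_derive (fun s => Re (f (z + RtoC s * v)%C)) t (Re (l * v)).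
Proof.
intros H. apply has_partials_line in H.
replace (l * v)%C with (l * RtoC (Re v) + Ci * l * RtoC (Im v))%C; [exact H|].
apply injective_projections; unfold Re, Im; simpl; ring.
Qed.

(** If dg = l dzeta then g has complex derivative l in the coordinate zeta.
The expansion property of zeta makes the error o(|z - z0|) also
o(|zeta - zeta0|). *)
Lemma has_cderiv_inverse zeta inv g w l a b :
  (exists delta, 0 < delta /\ forall v, Cmod (v - w) < delta ->
     zeta (inv v) = v /\ Cmod (inv v - inv w) <= Cmod (v - w)) ->
  has_partials zeta (inv w) a b -> has_partials g (inv w) (l * a)%C (l * b)%C ->
  has_cderiv (fun v => g (inv v)) w l.
Proof.
intros [d1 [Hd1 K1]] Hz Hg eps Heps.
assert (H := has_partials_plus _ _ _ _ _ _ _ Hg (has_partials_scal (- l)%C _ _ _ _ Hz)).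
destruct (H eps Heps) as [d2 [Hd2 K2]].
exists (Rmin d1 d2). split; [now apply Rmin_glb_lt|]. intros v Hv.
destruct (K1 v (Rlt_le_trans _ _ _ Hv (Rmin_l _ _))) as [E L].
destruct (K1 w) as [E0 _].
{ replace (w - w)%C with (RtoC 0) by ring. now rewrite Cmod_0. }
assert (Hv2 := Rlt_le_trans _ _ _ Hv (Rmin_r _ _)).
specialize (K2 (inv v) ltac:(lra)). cbv beta in K2. rewrite E, E0 in K2.
apply Rle_trans with (eps * Cmod (inv v - inv w)); [|now apply Rmult_le_compat_l; [lra|]].
eapply Rle_trans; [|exact K2]. right. f_equal.
replace (l * RtoC (Re (v - w)) + Ci * l * RtoC (Im (v - w)))%C with (l * (v - w))%C.
- ring.
- replace (v - w)%C with (RtoC (Re (v - w)) + Ci * RtoC (Im (v - w)))%C at 1; [ring|].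
  apply injective_projections; unfold Re, Im; simpl; ring.
Qed.

(** * Maxima on compact sets *)

Lemma locally_Cmod (z : C) (P : C -> Prop) :
  locally (T := C_UniformSpace) z P <->
  exists delta, 0 < delta /\ forall w, Cmod (w - z) < delta -> P w.
Proof.
split.
- intros [e He]. exists e. split; [apply cond_pos|]. intros w Hw. apply He.
  apply C_NormedModule_mixin_compat1. exact Hw.
- intros [d [Hd K]]. exists (mkposreal (d / 2) ltac:(lra)). intros w Hw. apply K.
  apply C_NormedModule_mixin_compat2 in Hw. simpl in Hw.
  assert (sqrt 2 <= 2).
  { rewrite <- (sqrt_Rsqr 2) at 2 by lra. apply sqrt_le_1_alt. unfold Rsqr; lra. }
  eapply Rlt_le_trans; [exact Hw|]. nra.
Qed.

Lemma has_partials_continuous f z a b :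
  has_partials f z a b -> continuous (T := C_UniformSpace) (U := C_UniformSpace) f z.
Proof.
intros H P HP. apply locally_Cmod. apply locally_Cmod in HP.
destruct HP as [e [He K]].
destruct (has_partials_Lipschitz _ _ _ _ H) as [M [d [HM [Hd L]]]].
exists (Rmin d (e / M)). assert (0 < e / M) by now apply Rdiv_lt_0_compat.
split; [now apply Rmin_glb_lt|]. intros w Hw. apply K.
eapply Rle_lt_trans; [apply L; eapply Rlt_le_trans; [exact Hw|apply Rmin_l]|].
assert (A := Rlt_le_trans _ _ _ Hw (Rmin_r _ _)).
apply Rlt_le_trans with (M * (e / M)); [now apply Rmult_lt_compat_l|]. right; field; lra.
Qed.

Lemma continuous_Cmod_sqr (z : C) :
  continuous (T := C_UniformSpace) (fun w : C => Re w ^ 2 + Im w ^ 2) z.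
Proof.
unfold Re, Im. simpl.
repeat first [apply (continuous_plus (V := R_NormedModule)) | apply (continuous_mult (K := R_AbsRing))
  | apply continuous_const | apply (continuous_fst (U := R_UniformSpace)) | apply (continuous_snd (U := R_UniformSpace)) ].
Qed.

Lemma continuous_Cmod (z : C) : continuous (T := C_UniformSpace) (fun w : C => Cmod w) z.
Proof.
apply (continuous_ext (fun w : C => sqrt (Re w ^ 2 + Im w ^ 2))); [reflexivity|].
apply (continuous_comp (fun w : C => Re w ^ 2 + Im w ^ 2) sqrt); [apply continuous_Cmod_sqr|].
apply continuous_sqrt.
Qed.

(** If the maximum is not attained, every point of [K] has a neighbourhood on
which [f] stays below one of its own values.  Finitely many such neighbourhoods
cover [K], and the largest of the corresponding values is below itself. *)
Lemma max_on_compact (K : C -> Prop) (f : C -> R) (M : R) :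
  (exists z, K z) -> (forall z, K z -> Cmod z <= M) ->
  (forall z, ~ K z -> locally (T := C_UniformSpace) z (fun w => ~ K w)) ->
  (forall z, K z -> continuous (T := C_UniformSpace) f z) ->
  exists z, K z /\ forall w, K w -> f w <= f z.
Proof.
intros [k0 Hk0] Hbd Hcl Hcont. apply NNPP. intros Hno.
assert (Hup : forall z, K z -> exists w, K w /\ f z < f w).
{ intros z Hz. apply NNPP. intros H. apply Hno. exists z. split; [exact Hz|].
  intros w Hw. apply Rnot_lt_le. intros L. apply H. now exists w. }
assert (Hloc : forall x : Compactness.Tn 2 R, exists delta : posreal, exists w, K w /\
  forall z : C, close_n 2 delta ((fst z, (snd z, tt)) : Compactness.Tn 2 R) x -> K z -> f z < f w).
{ intros [x1 [x2 []]].
  assert (H : exists w, K w /\ locally (T := C_UniformSpace) (x1, x2) (fun z => K z -> f z < f w)).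
  { destruct (classic (K (x1, x2))) as [Hx|Hx].
    - destruct (Hup _ Hx) as [w [Hw L]]. exists w. split; [exact Hw|].
      assert (C := Hcont _ Hx (fun y => y < f w) (open_lt (f w) _ L)).
      unfold filtermap in C. revert C. apply filter_imp. auto.
    - exists k0. split; [exact Hk0|]. generalize (Hcl _ Hx). apply filter_imp. tauto. }
  destruct H as [w [Hw [e He]]]. exists e, w. split; [exact Hw|].
  intros z [Hz1 [Hz2 _]] Kz. apply He; [split; assumption|exact Kz]. }
set (delta := fun x => proj1_sig (constructive_indefinite_description _ (Hloc x))).
set (a := ((- M, (- M, tt)) : Compactness.Tn 2 R)).
set (b := ((M, (M, tt)) : Compactness.Tn 2 R)).
apply (compactness_list 2 a b delta). intros [l Hl].
assert (Hlist : forall l : list (Compactness.Tn 2 R), exists w, K w /\ forall (z : C) t,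
  In t l -> close_n 2 (delta t) ((fst z, (snd z, tt)) : Compactness.Tn 2 R) t -> K z -> f z < f w).
{ clear l Hl. induction l as [|t l [w [Hw IH]]].
  - exists k0. split; [exact Hk0|]. intros z t [].
  - destruct (proj2_sig (constructive_indefinite_description _ (Hloc t))) as [w' [Hw' Ht]].
    fold (delta t) in Ht.
    destruct (Rle_dec (f w) (f w')) as [L|L].
    + exists w'. split; [exact Hw'|]. intros z s [<-|Hs] Hc Kz; [auto|].
      eapply Rlt_le_trans; [eapply IH; eauto|exact L].
    + exists w. split; [exact Hw|]. intros z s [<-|Hs] Hc Kz; [|eauto].
      specialize (Ht z Hc Kz). lra. }
destruct (Hlist l) as [w [Hw Hmax]].
destruct (Hl (fst w, (snd w, tt))) as [t [Ht [_ Hc]]].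
{ assert (A1 := Hbd _ Hw). assert (A2 := re_le_Cmod w). assert (A3 := im_le_Cmod w).
  unfold Re, Im in *. apply Rabs_le_between in A2, A3.
  simpl. repeat split; lra. }
specialize (Hmax w t Ht Hc Hw). lra.
Qed.

(** * The Schwarz lemma *)

Lemma second_derivative_at_local_max (g g1 : R -> R) (a l : R) :
  locally a (fun t => is_derive g t (g1 t)) -> is_derive g1 a l ->
  locally a (fun t => g t <= g a) -> l <= 0.
Proof.
intros [d1 H1] H2 [d2 H3]. apply Rnot_lt_le. intros Hl.
apply is_derive_Reals in H2. destruct (H2 (l / 2)) as [d3 H4]; [lra|].
set (d := Rmin d1 (Rmin d2 d3) / 2).
assert (Hd : 0 < d /\ d < d1 /\ d < d2 /\ d < d3).
{ unfold d. assert (A := cond_pos d1). assert (B := cond_pos d2). assert (C := cond_pos d3).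
  unfold Rmin. repeat destruct Rle_dec; lra. }
assert (Hball : forall (e : posreal) t, Rabs (t - a) < e -> ball a e t).
{ intros e t Ht. exact Ht. }
assert (D : forall t, Rabs (t - a) <= d -> derivable_pt_lim g t (g1 t)).
{ intros t Ht. apply is_derive_Reals, H1, Hball. lra. }
assert (Da : derivable_pt_lim g a (g1 a)).
{ apply D. rewrite Rabs_pos_eq; lra. }
assert (Z : g1 a = 0).
{ rewrite <- (deriv_maximum g (a - d) (a + d) a (exist _ _ Da)); try lra.
  - symmetry. now apply derive_pt_eq_0.
  - intros x Hx1 Hx2. apply H3, Hball. apply Rabs_def1; lra. }
destruct (MVT_cor2 g g1 a (a + d)) as [c [E Hc]]; [lra| |].
{ intros c Hc. apply D. rewrite Rabs_pos_eq; lra. }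
assert (L : g (a + d) <= g a) by (apply H3, Hball; rewrite Rabs_pos_eq; lra).
specialize (H4 (c - a) ltac:(lra) ltac:(rewrite Rabs_pos_eq; lra)).
replace (a + (c - a)) with c in H4 by ring. rewrite Z in H4.
apply Rabs_def2 in H4.
assert (X : g1 c = (g1 c - 0) / (c - a) * (c - a)) by (field; lra).
assert (0 < g1 c) by (rewrite X; apply Rmult_lt_0_compat; lra).
replace (a + d - a) with d in E by ring.
assert (0 < g1 c * d) by (apply Rmult_lt_0_compat; lra).
lra.
Qed.

Lemma C_neq_0_iff_sqr (z : C) : z <> 0%C <-> 0 < Re z ^ 2 + Im z ^ 2.
Proof.
rewrite <- Cmod2_alt, Cmod_gt_0. split; intros H; [nra|].
assert (A := Cmod_ge_0 z). nra.
Qed.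

(** The second-derivative test along the line through [z] in the unit
direction [v], for the sum of a harmonic function, a multiple of |w|^2 and a
multiple of log |w|^2. *)
Lemma no_interior_max_directional (Q Q1 Q2 : C -> C) (z v : C) (a e : R) :
  z <> 0%C -> Re v ^ 2 + Im v ^ 2 = 1 ->
  locally (T := C_UniformSpace) z (fun w => has_cderiv Q w (Q1 w)) ->
  has_cderiv Q1 z (Q2 z) ->
  locally (T := C_UniformSpace) z (fun w =>
    Re (Q w) + a * (Re w ^ 2 + Im w ^ 2) + e * ln (Re w ^ 2 + Im w ^ 2) <=
    Re (Q z) + a * (Re z ^ 2 + Im z ^ 2) + e * ln (Re z ^ 2 + Im z ^ 2)) ->
  Re (Q2 z * (v * v)) + 2 * a
    + e * (2 / (Re z ^ 2 + Im z ^ 2)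
           - 4 * (Re z * Re v + Im z * Im v) ^ 2 / (Re z ^ 2 + Im z ^ 2) ^ 2) <= 0.
Proof.
intros Hz Hv HQ HQ1 Hmax.
set (N := fun t => Re z ^ 2 + Im z ^ 2 + 2 * (Re z * Re v + Im z * Im v) * t + t ^ 2).
assert (EN : forall t, Re (z + RtoC t * v) ^ 2 + Im (z + RtoC t * v) ^ 2 = N t).
{ intros t. unfold N. replace (t ^ 2) with (t ^ 2 * (Re v ^ 2 + Im v ^ 2)) by (rewrite Hv; ring).
  unfold Re, Im; simpl; ring. }
assert (N0 : N 0 = Re z ^ 2 + Im z ^ 2) by (unfold N; ring).
assert (P0 : 0 < N 0) by (rewrite N0; now apply C_neq_0_iff_sqr).
assert (Cline : continuous (T := R_UniformSpace) (U := C_UniformSpace) (fun t : R => z + RtoC t * v)%C 0).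
{ intros P HP. replace (z + RtoC 0 * v)%C with z in HP by ring. apply locally_Cmod in HP.
  destruct HP as [d [Hd K]]. assert (Hv0 := Cmod_ge_0 v).
  assert (Hd' : 0 < d / (Cmod v + 1)) by (apply Rdiv_lt_0_compat; lra).
  exists (mkposreal _ Hd'). intros t Ht. apply K.
  replace (z + RtoC t * v - z)%C with (RtoC t * v)%C by ring.
  rewrite Cmod_mult, Cmod_R.
  assert (Ht' : Rabs (t - 0) < d / (Cmod v + 1)) by exact Ht. rewrite Rminus_0_r in Ht'.
  apply Rle_lt_trans with (Rabs t * (Cmod v + 1)).
  - apply Rmult_le_compat_l; [apply Rabs_pos|lra].
  - apply Rlt_le_trans with (d / (Cmod v + 1) * (Cmod v + 1)).
    + apply Rmult_lt_compat_r; lra.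
    + right; field; lra. }
assert (Z0 : (z + RtoC 0 * v)%C = z) by ring.
assert (L : forall P : C -> Prop, locally (T := C_UniformSpace) z P -> locally 0 (fun t => P (z + RtoC t * v)%C)).
{ intros P HP. apply Cline. now rewrite Z0. }
assert (CN : continuous N 0).
{ apply (ex_derive_continuous N). unfold N. auto_derive. exact I. }
assert (LN : locally 0 (fun t => 0 < N t)) by exact (CN _ (open_gt 0 _ P0)).
rewrite <- N0.
refine (second_derivative_at_local_max
  (fun t => Re (Q (z + RtoC t * v)%C) + a * N t + e * ln (N t))
  (fun t => Re (Q1 (z + RtoC t * v)%C * v) + a * (2 * (Re z * Re v + Im z * Im v) + 2 * t)
            + e * ((2 * (Re z * Re v + Im z * Im v) + 2 * t) / N t)) 0 _ _ _ _).
- generalize (filter_and _ _ (L _ HQ) LN). apply filter_imp. intros t [Ht HN].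
  apply (is_derive_plus (V := R_NormedModule)); [apply (is_derive_plus (V := R_NormedModule))|].
  + now apply has_cderiv_line.
  + unfold N. auto_derive; [exact I|ring].
  + unfold N in *. auto_derive; [simpl in *; lra|]. field. simpl in *; lra.
- replace (Re (Q2 z * (v * v)) + 2 * a + e * (2 / N 0 - 4 * (Re z * Re v + Im z * Im v) ^ 2 / N 0 ^ 2))
    with (Re (v * Q2 z * v) + 2 * a + e * (2 / N 0 - 4 * (Re z * Re v + Im z * Im v) ^ 2 / N 0 ^ 2))
    by (f_equal; f_equal; f_equal; ring).
  apply (is_derive_plus (V := R_NormedModule)); [apply (is_derive_plus (V := R_NormedModule))|].
  + apply (is_derive_ext (fun t => Re (v * Q1 (z + RtoC t * v)%C))).
    { intros t. f_equal. ring. }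
    apply (has_cderiv_line (fun w => v * Q1 w)%C). rewrite Z0. now apply has_cderiv_scal.
  + auto_derive; [exact I|ring].
  + unfold N in *. auto_derive; [simpl in *; lra|]. field. simpl in *; lra.
- generalize (L _ Hmax). apply filter_imp. intros t Ht. cbv beta in Ht. rewrite Z0, <- !EN, Z0. exact Ht.
Qed.

(** In the sum of the tests in the directions 1 and i the terms of [Q] cancel,
because (i)^2 = -1, and so do those of the logarithm.  What remains is the
Laplacian 4 a of the quadratic term, which is positive. *)
Lemma no_interior_max (Q Q1 Q2 : C -> C) (z : C) (a e : R) :
  z <> 0%C -> 0 < a ->
  locally (T := C_UniformSpace) z (fun w => has_cderiv Q w (Q1 w)) ->
  has_cderiv Q1 z (Q2 z) ->
  ~ locally (T := C_UniformSpace) z (fun w =>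
    Re (Q w) + a * (Re w ^ 2 + Im w ^ 2) + e * ln (Re w ^ 2 + Im w ^ 2) <=
    Re (Q z) + a * (Re z ^ 2 + Im z ^ 2) + e * ln (Re z ^ 2 + Im z ^ 2)).
Proof.
intros Hz Ha HQ HQ1 Hmax.
assert (Hx := no_interior_max_directional Q Q1 Q2 z 1%C a e Hz ltac:(simpl; ring) HQ HQ1 Hmax).
assert (Hy := no_interior_max_directional Q Q1 Q2 z Ci a e Hz ltac:(simpl; ring) HQ HQ1 Hmax).
apply C_neq_0_iff_sqr in Hz.
replace (Q2 z * (1 * 1))%C with (Q2 z) in Hx by ring.
replace (Q2 z * (Ci * Ci))%C with (- Q2 z)%C in Hy by (replace (Ci * Ci)%C with (- (1))%C by (apply injective_projections; simpl; ring); ring).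
rewrite re_opp in Hy.
replace (Re 1) with 1 in Hx by reflexivity. replace (Im 1) with 0 in Hx by reflexivity.
replace (Re Ci) with 0 in Hy by reflexivity. replace (Im Ci) with 1 in Hy by reflexivity.
set (x := Re z) in *. set (y := Im z) in *.
assert (E : 2 / (x ^ 2 + y ^ 2) - 4 * (x * 1 + y * 0) ^ 2 / (x ^ 2 + y ^ 2) ^ 2
   + (2 / (x ^ 2 + y ^ 2) - 4 * (x * 0 + y * 1) ^ 2 / (x ^ 2 + y ^ 2) ^ 2) = 0) by (field; lra).
nra.
Qed.

(** A harmonic function that is bounded above near an isolated singularity
obeys the maximum principle there.  With a and e small, the function
Re Q + a |z|^2 + e log |z|^2 is below its value at [z1] near 0, because of
the logarithm, and on the outer circle, because of the hypothesis; its maximum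
would then be interior. *)
Lemma punctured_max_principle (r B M k : R) (Q Q1 Q2 : C -> C) :
  0 < k ->
  (forall z, 0 < Cmod z <= r -> has_cderiv Q z (Q1 z) /\ has_cderiv Q1 z (Q2 z)) ->
  (forall z, Cmod z = r -> Re (Q z) <= B) ->
  (forall z, 0 < Cmod z < k -> Re (Q z) <= M) ->
  forall z, 0 < Cmod z <= r -> Re (Q z) <= B.
Proof.
intros Hk HQ HB HM z1 Hz1. apply Rnot_lt_le. intros Hlt.
set (gap := Re (Q z1) - B).
assert (Hgap : Re (Q z1) = B + gap) by (unfold gap; ring).
assert (Hgap0 : 0 < gap) by (unfold gap; lra).
clearbody gap.
assert (Hr : 0 < r) by lra.
set (a := gap / (4 * r ^ 2)).
assert (Hr2 : 0 < r ^ 2) by (apply pow_lt; lra).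
assert (Ha : 0 < a) by (apply Rdiv_lt_0_compat; lra).
assert (Har : a * r ^ 2 = gap / 4) by (unfold a; field; lra).
assert (Esq : forall w : C, Re w ^ 2 + Im w ^ 2 = Cmod w ^ 2) by (intros w; now rewrite Cmod2_alt).
assert (Hsq1 : 0 < Cmod z1 ^ 2) by (apply pow_lt; lra).
assert (Hln1 : ln (Cmod z1 ^ 2) <= ln (r ^ 2)).
{ apply ln_le; [exact Hsq1|]. apply pow_incr; lra. }
set (e := gap / 4 / (ln (r ^ 2) - ln (Cmod z1 ^ 2) + 1)).
assert (He : 0 < e) by (apply Rdiv_lt_0_compat; lra).
assert (Hel : e * (ln (r ^ 2) - ln (Cmod z1 ^ 2)) <= gap / 4).
{ apply Rle_trans with (e * (ln (r ^ 2) - ln (Cmod z1 ^ 2) + 1)); [nra|].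
  right. unfold e. field. lra. }
clearbody a e.
set (h := fun w : C => Re (Q w) + a * (Re w ^ 2 + Im w ^ 2) + e * ln (Re w ^ 2 + Im w ^ 2)).
assert (Hh1 : B + 3 / 4 * gap + e * ln (r ^ 2) <= h z1).
{ unfold h. rewrite Esq. assert (0 <= a * Cmod z1 ^ 2) by (apply Rmult_le_pos; lra).
  rewrite Rmult_minus_distr_l in Hel.  lra. }
(* below the radius [k1] the logarithm outweighs the bound [M] *)
set (k1 := Rmin (Cmod z1) (Rmin (k / 2) (exp ((ln (r ^ 2) - (Rabs M + Rabs B) / e) / 2)))).
assert (Hk1 : 0 < k1).
{ unfold k1. repeat apply Rmin_glb_lt; [lra|lra|apply exp_pos]. }
assert (Hk1a : k1 <= Cmod z1) by apply Rmin_l.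
assert (Hk1b : k1 <= k / 2) by (eapply Rle_trans; [apply Rmin_r|apply Rmin_l]).
assert (Hk1c : ln (k1 ^ 2) <= ln (r ^ 2) - (Rabs M + Rabs B) / e).
{ rewrite <- Rsqr_pow2. unfold Rsqr. rewrite ln_mult by assumption.
  assert (ln k1 <= (ln (r ^ 2) - (Rabs M + Rabs B) / e) / 2); [|lra].
  rewrite <- (ln_exp ((ln (r ^ 2) - (Rabs M + Rabs B) / e) / 2)).
  apply ln_le; [exact Hk1|]. eapply Rle_trans; [apply Rmin_r|apply Rmin_r]. }
destruct (max_on_compact (fun z => k1 <= Cmod z <= r) h r) as [z0 [Hz0 Hmax]].
- exists z1. lra.
- intros z Hz. apply Hz.
- intros z Hz. destruct (Rlt_le_dec (Cmod z) k1) as [L|L].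
  + generalize (continuous_Cmod z _ (open_lt k1 _ L)). unfold filtermap. apply filter_imp. intros w Hw Hw'. lra.
  + assert (L' : r < Cmod z) by lra.
    generalize (continuous_Cmod z _ (open_gt r _ L')). unfold filtermap. apply filter_imp. intros w Hw Hw'. lra.
- intros z Hz. unfold h.
  apply (continuous_plus (V := R_NormedModule)); [apply (continuous_plus (V := R_NormedModule))|].
  + apply (continuous_comp (U := C_UniformSpace) Q Re).
    * eapply has_partials_continuous. apply HQ. lra.
    * apply (continuous_fst (U := R_UniformSpace)).
  + apply (continuous_mult (K := R_AbsRing)); [apply continuous_const|apply continuous_Cmod_sqr].
  + apply (continuous_mult (K := R_AbsRing)); [apply continuous_const|].
    apply (continuous_comp (fun w : C => Re w ^ 2 + Im w ^ 2) ln); [apply continuous_Cmod_sqr|].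
    apply (ex_derive_continuous ln). exists (/ (Re z ^ 2 + Im z ^ 2)). apply is_derive_Reals.
    apply derivable_pt_lim_ln. rewrite Esq. apply pow_lt. lra.
- assert (H1 := Hmax z1 ltac:(lra)).
  assert (Nr : Cmod z0 < r).
  { destruct (Rle_lt_or_eq_dec _ _ (proj2 Hz0)) as [|E]; [assumption|]. exfalso.
    specialize (HB z0 E). unfold h in H1 at 2. rewrite Esq, E in H1. lra. }
  assert (Nk : k1 < Cmod z0).
  { destruct (Rle_lt_or_eq_dec _ _ (proj1 Hz0)) as [|E]; [assumption|]. exfalso.
    specialize (HM z0 ltac:(lra)). unfold h in H1 at 2. rewrite Esq, <- E in H1.
    assert (a * k1 ^ 2 <= a * r ^ 2).
    { apply Rmult_le_compat_l; [lra|]. apply pow_incr; lra. }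
    assert (e * ln (k1 ^ 2) <= e * ln (r ^ 2) - (Rabs M + Rabs B)).
    { apply Rle_trans with (e * (ln (r ^ 2) - (Rabs M + Rabs B) / e)).
      - apply Rmult_le_compat_l; lra.
      - right. field. lra. }
    assert (A1 := Rle_abs M). assert (A2 := Rle_abs (- B)). rewrite Rabs_Ropp in A2.
    lra. }
  assert (Hloc : locally (T := C_UniformSpace) z0 (fun w => k1 <= Cmod w <= r)).
  { generalize (filter_and _ _ (continuous_Cmod z0 _ (open_gt k1 _ Nk)) (continuous_Cmod z0 _ (open_lt r _ Nr))).
    unfold filtermap. apply filter_imp. intros w [X Y]. lra. }
  apply (no_interior_max Q Q1 Q2 z0 a e).
  + apply Cmod_gt_0. lra.
  + exact Ha.
  + revert Hloc. apply filter_imp. intros w Hw. apply HQ. lra.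
  + apply HQ. lra.
  + revert Hloc. apply filter_imp. intros w Hw. exact (Hmax w Hw).
Qed.

Lemma exists_unit_rotation (z : C) : exists c, Cmod c = 1 /\ Re (c * z) = Cmod z.
Proof.
destruct (Req_dec (Cmod z) 0) as [E|N].
- exists 1%C. split; [apply Cmod_1|]. rewrite (Cmod_eq_0 _ E). rewrite Cmod_0. simpl; ring.
- assert (P := Cmod_ge_0 z).
  exists (Cconj z / RtoC (Cmod z))%C. 
  assert (RtoC (Cmod z) <> 0%C) by (apply Cmod_gt_0; rewrite Cmod_R, Rabs_pos_eq; lra).
  split.
  + rewrite Cmod_div by assumption. rewrite Cmod_conj, Cmod_R, Rabs_pos_eq by exact P. field. exact N.
  + replace (Cconj z / RtoC (Cmod z) * z)%C with (z * Cconj z / RtoC (Cmod z))%C by (field; assumption).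
    rewrite <- Cmod2_conj, <- RtoC_div by exact N. simpl. field. exact N.
Qed.

(** The maximum principle for Re (c f(z) / z) on the disc of radius r, with
|c| = 1 chosen so that the real part is the modulus at the given point; then r
tends to [rho].  The origin is left out of the hypotheses because the lemma is
also applied to functions that are defined as quotients by z. *)
Lemma Schwarz_lemma (rho M k : R) (f f1 f2 : C -> C) :
  0 < k ->
  (forall z, 0 < Cmod z < rho -> has_cderiv f z (f1 z) /\ has_cderiv f1 z (f2 z)) ->
  (forall z, 0 < Cmod z < rho -> Cmod (f z) <= 1) ->
  (forall z, 0 < Cmod z < k -> Cmod (f z) <= M * Cmod z) ->
  forall z, 0 < Cmod z < rho -> Cmod (f z) <= Cmod z / rho.
Proof.
intros Hk Hf Hf1 HM z Hz.
assert (Key : forall r, Cmod z <= r < rho -> Cmod (f z) <= Cmod z / r).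
{ intros r Hr. destruct (exists_unit_rotation (f z / z)%C) as [c [Hc E]].
  assert (Nz : z <> 0%C) by (apply Cmod_gt_0; lra).
  rewrite Cmod_div in E by exact Nz.
  assert (L : Cmod (f z) / Cmod z <= 1 / r).
  { rewrite <- E.
    assert (Bd : forall w b, Cmod (f w) <= b -> 0 < Cmod w -> Re (c * (f w / w)) <= b / Cmod w).
    { intros w b Hb Hw. eapply Rle_trans; [eapply Rle_trans; [apply Rle_abs|apply re_le_Cmod]|].
      rewrite Cmod_mult, Hc, Rmult_1_l, Cmod_div by (apply Cmod_gt_0; exact Hw).
      apply Rmult_le_compat_r; [left; now apply Rinv_0_lt_compat|exact Hb]. }
    apply (punctured_max_principle r (1 / r) M k (fun w => c * (f w / w))%C
      (fun w => c * ((f1 w - f w / w * 1) / w))%C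
      (fun w => c * ((f2 w - ((f1 w - f w / w * 1) / w * 1) - (f1 w - f w / w * 1) / w * 1) / w))%C Hk).
    - intros w Hw. assert (Nw : w <> 0%C) by (apply Cmod_gt_0; lra).
      destruct (Hf w ltac:(lra)) as [D1 D2].
      assert (D3 := has_cderiv_div _ _ _ _ _ D1 (has_cderiv_id w) Nw).
      split; [now apply has_cderiv_scal|]. apply has_cderiv_scal.
      apply (has_cderiv_div (fun w => f1 w - f w / w * 1)%C (fun w => w)); [|apply has_cderiv_id|exact Nw].
      replace (f2 w - (f1 w - f w / w * 1) / w * 1)%C with (f2 w + (- (1)) * ((f1 w - f w / w * 1) / w))%C
        by (field; exact Nw).
      apply (has_partials_ext (fun w => f1 w + (- (1)) * (f w / w))%C); [intros; ring|].
      apply has_cderiv_plus; [exact D2|]. now apply has_cderiv_scal.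
    - intros w Hw. rewrite <- Hw. apply Bd; [apply Hf1; lra|lra].
    - intros w Hw. eapply Rle_trans; [apply Bd; [now apply HM|apply Hw]|]. right. field. lra.
    - lra. }
  apply (Rmult_le_compat_r (Cmod z)) in L; [|lra].
  replace (Cmod (f z) / Cmod z * Cmod z) with (Cmod (f z)) in L by (field; lra).
  replace (1 / r * Cmod z) with (Cmod z / r) in L by (field; lra). exact L. }
apply Rle_div_r; [lra|]. apply le_epsilon. intros e He.
set (r := Rmax (Cmod z) (rho - e)).
assert (Hr : Cmod z <= r < rho) by (unfold r, Rmax; destruct Rle_dec; lra).
assert (Hr' : rho - e <= r) by apply Rmax_r.
specialize (Key r Hr). specialize (Hf1 z Hz).
apply (Rmult_le_compat_r r) in Key; [|lra].
replace (Cmod z / r * r) with (Cmod z) in Key by (field; lra).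
assert (P := Cmod_ge_0 (f z)). nra.
Qed.

(** Integration of |f| along the segment from 0 to [z], written as the
monotonicity in t of Re (c F(t z)) - M |z|^2 t^2 / 2. *)
Lemma primitive_bound (rho M : R) (F f : C -> C) :
  F 0%C = 0%C ->
  (forall z, Cmod z < rho -> has_cderiv F z (f z)) ->
  (forall z, Cmod z < rho -> Cmod (f z) <= M * Cmod z) ->
  forall z, Cmod z < rho -> Cmod (F z) <= M * Cmod z ^ 2 / 2.
Proof.
intros F0 HF Hf z Hz. destruct (exists_unit_rotation (F z)) as [c [Hc E]].
assert (P := Cmod_ge_0 z).
assert (T : forall t, 0 <= t <= 1 -> Cmod (0 + RtoC t * z) = t * Cmod z).
{ intros t Ht. rewrite Cplus_0_l, Cmod_mult, Cmod_R, Rabs_pos_eq; lra. }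
destruct (MVT_cor2 (fun t => Re (c * F (0 + RtoC t * z)%C) - M * Cmod z ^ 2 / 2 * t ^ 2)
  (fun t => Re (c * f (0 + RtoC t * z)%C * z) - M * Cmod z ^ 2 * t) 0 1) as [t [Ht Hlt]].
- lra.
- intros t Ht. apply is_derive_Reals. apply (is_derive_minus (V := R_NormedModule)).
  + apply (has_cderiv_line (fun w => c * F w)%C). apply has_cderiv_scal, HF. rewrite T by exact Ht. nra.
  + auto_derive; [exact I|]. field.
- replace (RtoC 0 + RtoC 1 * z)%C with z in Ht by ring. replace (RtoC 0 + RtoC 0 * z)%C with (RtoC 0) in Ht by ring.
  rewrite F0, E in Ht. replace (Re (c * 0)) with 0 in Ht by (rewrite Cmult_0_r; reflexivity).
  assert (L : Re (c * f (0 + RtoC t * z)%C * z) <= M * Cmod z ^ 2 * t).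
  { eapply Rle_trans; [eapply Rle_trans; [apply Rle_abs|apply re_le_Cmod]|].
    rewrite !Cmod_mult, Hc. specialize (Hf (0 + RtoC t * z)%C). rewrite T in Hf by lra.
    specialize (Hf ltac:(nra)).
    apply Rle_trans with (M * (t * Cmod z) * Cmod z); [|right; ring].
    apply Rmult_le_compat_r; lra. }
  lra.
Qed.

(** Let G = f / (l z) - 1, which vanishes at 0.  The Schwarz inequality gives
Re G <= 0, so for every A > 0 the function G / (A - G) has modulus at most 1
and vanishes at 0.  The Schwarz inequality for this function reads
|G| (rho - |z|) <= A |z|, and A is arbitrary. *)
Lemma Schwarz_rigidity (rho : R) (f f1 f2 : C -> C) :
  0 < rho ->
  (forall z, Cmod z < rho -> has_cderiv f z (f1 z) /\ has_cderiv f1 z (f2 z)) ->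
  (forall z, Cmod z < rho -> Cmod (f z) <= 1) ->
  f 0%C = 0%C -> Cmod (f1 0%C) = / rho ->
  forall z, Cmod z < rho -> f z = (f1 0%C * z)%C.
Proof.
intros Hrho Hf Hf1 f0 Hd.
set (l := f1 0%C) in *.
(* first-order expansion of [f] at the origin *)
assert (Exp : exists M k, 0 < k <= rho /\ forall z, Cmod z < k -> Cmod (f z - l * z) <= M * Cmod z ^ 2).
{ destruct (Hf 0%C) as [_ D]; [rewrite Cmod_0; lra|].
  destruct (has_partials_Lipschitz _ _ _ _ D) as [M [d [HM [Hd0 K]]]].
  exists (M / 2), (Rmin d rho).
  split; [split; [now apply Rmin_glb_lt|apply Rmin_r]|]. intros z Hz.
  replace (M / 2 * Cmod z ^ 2) with (M * Cmod z ^ 2 / 2) by field.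
  apply (primitive_bound (Rmin d rho) M (fun w => f w - l * w)%C (fun w => f1 w - f1 0)%C); [..|exact Hz].
  - rewrite f0. ring.
  - intros w Hw.
    apply (has_partials_ext (fun w => f w + - l * w)%C); [intros; ring|].
    replace (f1 w - f1 0)%C with (f1 w + - l * 1)%C by (unfold l; ring).
    apply has_cderiv_plus; [apply Hf; eapply Rlt_le_trans; [exact Hw|apply Rmin_r]|].
    apply has_cderiv_scal, has_cderiv_id.
  - intros w Hw. replace (Cmod w) with (Cmod (w - 0)) by (f_equal; ring).
    apply K. replace (w - 0)%C with w by ring. eapply Rlt_le_trans; [exact Hw|apply Rmin_l]. }
destruct Exp as [M [k [[Hk Hkr] Exp]]].
assert (Nl : l <> 0%C) by (apply Cmod_gt_0; rewrite Hd; now apply Rinv_0_lt_compat).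
assert (HSch : forall z, 0 < Cmod z < rho -> Cmod (f z) <= Cmod z / rho).
{ apply (Schwarz_lemma rho (M * k + / rho) k f f1 f2 Hk).
  - intros z Hz. apply Hf, Hz.
  - intros z Hz. apply Hf1, Hz.
  - intros z Hz. specialize (Exp z (proj2 Hz)).
    assert (A := Cmod_sub_triangle (f z) (l * z)). rewrite Cmod_mult, Hd in A.
    assert (0 <= M).
    { assert (B := Cmod_ge_0 (f z - l * z)). apply Rnot_lt_le. intros HM.
      assert (0 < Cmod z ^ 2) by (apply pow_lt; lra). nra. }
    assert (M * Cmod z ^ 2 <= M * k * Cmod z).
    { replace (M * k * Cmod z) with (M * (k * Cmod z)) by ring.
      apply Rmult_le_compat_l; [assumption|]. nra. }
    lra. }
set (G := fun z => (f z / (l * z) - 1)%C).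
set (G1 := fun z => ((f1 z - f z / (l * z) * (l * 1)) / (l * z))%C).
set (G2 := fun z => ((f2 z - G1 z * (l * 1) - G1 z * (l * 1)) / (l * z))%C).
assert (DG : forall z, 0 < Cmod z < rho -> has_cderiv G z (G1 z) /\ has_cderiv G1 z (G2 z)).
{ intros z Hz. assert (Nz : z <> 0%C) by (apply Cmod_gt_0; lra).
  destruct (Hf z (proj2 Hz)) as [D1 D2].
  assert (D3 := has_cderiv_scal l _ _ _ (has_cderiv_id z)).
  assert (D4 : has_cderiv (fun z => f z / (l * z))%C z (G1 z)).
  { apply has_cderiv_div; [exact D1|exact D3|now apply Cmult_neq_0]. }
  split.
  - apply (has_partials_ext (fun z => f z / (l * z) + - (1))%C); [intros; unfold G; ring|].
    replace (G1 z) with (G1 z + 0)%C by ring.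
    apply has_cderiv_plus; [exact D4|apply has_cderiv_const].
  - unfold G2. apply (has_cderiv_div (fun z => f1 z - f z / (l * z) * (l * 1))%C (fun z => l * z)%C);
      [|exact D3|now apply Cmult_neq_0].
    replace (f2 z - G1 z * (l * 1))%C with (f2 z + - l * G1 z)%C by ring.
    apply (has_partials_ext (fun z => f1 z + - l * (f z / (l * z)))%C); [intros; ring|].
    apply has_cderiv_plus; [exact D2|]. now apply has_cderiv_scal. }
assert (ReG : forall z, 0 < Cmod z < rho -> Re (G z) <= 0).
{ intros z Hz. assert (Nz : z <> 0%C) by (apply Cmod_gt_0; lra).
  assert (A : Cmod (f z / (l * z)) <= 1).
  { rewrite Cmod_div by now apply Cmult_neq_0. rewrite Cmod_mult, Hd.
    apply Rle_div_l; [apply Rmult_lt_0_compat; [now apply Rinv_0_lt_compat|lra]|].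
    specialize (HSch z Hz). lra. }
  assert (B := Rle_trans _ _ _ (Rle_trans _ _ _ (Rle_abs _) (re_le_Cmod _)) A).
  unfold G. unfold Cminus. rewrite re_plus, re_opp, re_RtoC. lra. }
assert (Gnear : forall z, 0 < Cmod z < k -> Cmod (G z) <= M * rho * Cmod z).
{ intros z Hz. assert (Nz : z <> 0%C) by (apply Cmod_gt_0; lra).
  unfold G. replace (f z / (l * z) - 1)%C with ((f z - l * z) / (l * z))%C by (field; split; assumption).
  rewrite Cmod_div by now apply Cmult_neq_0. rewrite Cmod_mult, Hd.
  apply Rle_div_l; [apply Rmult_lt_0_compat; [now apply Rinv_0_lt_compat|lra]|].
  replace (M * rho * Cmod z * (/ rho * Cmod z)) with (M * Cmod z ^ 2) by (field; lra).
  apply Exp, Hz. }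
assert (Key : forall z A, 0 < Cmod z < rho -> 0 < A -> Cmod (G z) * (rho - Cmod z) <= A * Cmod z).
{ intros z A Hz HA.
  assert (ND : forall w, 0 < Cmod w < rho -> A <= Re (A - G w)).
  { intros w Hw. specialize (ReG w Hw). unfold Cminus. rewrite re_plus, re_opp, re_RtoC. lra. }
  assert (ND' : forall w, 0 < Cmod w < rho -> A <= Cmod (A - G w)).
  { intros w Hw. eapply Rle_trans; [apply ND, Hw|]. eapply Rle_trans; [apply Rle_abs|apply re_le_Cmod]. }
  assert (DA : forall w, 0 < Cmod w < rho -> (A - G w)%C <> 0%C).
  { intros w Hw. apply Cmod_gt_0. specialize (ND' w Hw). lra. }
  set (D1 := fun w => ((G1 w - G w / (A - G w) * (- (1) * G1 w)) / (A - G w))%C).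
  assert (HB : Cmod (G z / (A - G z)) <= Cmod z / rho).
  { apply (Schwarz_lemma rho (M * rho / A) k (fun w => G w / (A - G w))%C D1
     (fun w => ((G2 w - (D1 w * (- (1) * G1 w) + G w / (A - G w) * (- (1) * G2 w))
        - D1 w * (- (1) * G1 w)) / (A - G w))%C) Hk); [..|exact Hz].
    - intros w Hw. destruct (DG w Hw) as [H1 H2].
      assert (H3 : has_cderiv (fun w => A - G w)%C w (- (1) * G1 w)%C).
      { apply (has_partials_ext (fun w => A + - (1) * G w)%C); [intros; ring|].
        replace (- (1) * G1 w)%C with (0 + - (1) * G1 w)%C by ring.
        apply has_cderiv_plus; [apply has_cderiv_const|now apply has_cderiv_scal]. }
      assert (H4 : has_cderiv (fun w => G w / (A - G w))%C w (D1 w)).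
      { exact (has_cderiv_div _ _ _ _ _ H1 H3 (DA w Hw)). }
      split; [exact H4|].
      apply (has_cderiv_div (fun w => G1 w - G w / (A - G w) * (- (1) * G1 w))%C (fun w => A - G w)%C);
        [|exact H3|now apply DA].
      apply (has_partials_ext (fun w => G1 w + - (1) * (G w / (A - G w) * (- (1) * G1 w)))%C); [intros; ring|].
      replace (G2 w - (D1 w * (- (1) * G1 w) + G w / (A - G w) * (- (1) * G2 w)))%C with
        (G2 w + - (1) * (D1 w * (- (1) * G1 w) + G w / (A - G w) * (- (1) * G2 w)))%C by ring.
      apply has_cderiv_plus; [exact H2|]. apply has_cderiv_scal.
      apply (has_cderiv_mult (fun w => G w / (A - G w))%C (fun w => - (1) * G1 w)%C); [exact H4|].
      now apply has_cderiv_scal.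
    - intros w Hw. rewrite Cmod_div by now apply DA.
      apply Rle_div_l; [specialize (ND' w Hw); lra|]. rewrite Rmult_1_l.
      apply Rsqr_incr_0; [|apply Cmod_ge_0|apply Cmod_ge_0]. rewrite !Rsqr_pow2.
      assert (E := ReG w Hw).
      rewrite !Cmod2_alt. unfold Cminus. rewrite re_plus, re_opp, im_plus, im_opp, re_RtoC, im_RtoC.
      assert (0 <= A * - Re (G w)) by (apply Rmult_le_pos; lra). nra.
    - intros w Hw. assert (Hw' : 0 < Cmod w < rho) by lra. rewrite Cmod_div by now apply DA.
      specialize (Gnear w Hw). specialize (ND' w Hw').
      apply Rle_div_l; [lra|]. eapply Rle_trans; [exact Gnear|].
      assert (P := Cmod_ge_0 (G w)).
      replace (M * rho * Cmod w) with (M * rho / A * Cmod w * A) by (field; lra).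
      apply Rmult_le_compat_l; [|exact ND'].
      replace (M * rho / A * Cmod w) with (M * rho * Cmod w / A) by (field; lra).
      apply Rle_div_r; lra. }
  rewrite Cmod_div in HB by now apply DA. specialize (ND' z Hz).
  apply (proj1 (Rle_div_l _ _ (Cmod (A - G z)) ltac:(lra))) in HB.
  assert (T : Cmod (A - G z) <= A + Cmod (G z)).
  { eapply Rle_trans; [apply Cmod_triangle|]. rewrite Cmod_opp, Cmod_R, Rabs_pos_eq; lra. }
  assert (Cmod (G z) * rho <= Cmod z * Cmod (A - G z)).
  { apply (Rmult_le_compat_r rho) in HB; [|lra].
    replace (Cmod z / rho * Cmod (A - G z) * rho) with (Cmod z * Cmod (A - G z)) in HB by (field; lra).
    exact HB. }
  nra. }
intros z Hz. destruct (Req_dec (Cmod z) 0) as [E|N].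
- rewrite (Cmod_eq_0 _ E), f0. ring.
- assert (Hz' : 0 < Cmod z < rho) by (assert (P := Cmod_ge_0 z); lra).
  assert (Nz : z <> 0%C) by (apply Cmod_gt_0; lra).
  assert (G0 : G z = 0%C).
  { apply Cmod_eq_0. apply Rle_antisym; [|apply Cmod_ge_0].
    apply Rnot_lt_le. intros L.
    assert (Q : 0 < Cmod (G z) * (rho - Cmod z)) by (apply Rmult_lt_0_compat; lra).
    specialize (Key z (Cmod (G z) * (rho - Cmod z) / (2 * Cmod z)) Hz' ltac:(apply Rdiv_lt_0_compat; lra)).
    replace (Cmod (G z) * (rho - Cmod z) / (2 * Cmod z) * Cmod z) with
      (Cmod (G z) * (rho - Cmod z) / 2) in Key by (field; lra).
    lra. }
  replace (f z) with ((G z + 1) * (l * z))%C; [rewrite G0; ring|].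
  unfold G. field. split; assumption.
Qed.

(** * The Lewy map of a convex solution of the Monge-Ampere equation *)

(** The family [W] plays the role of the partial derivatives
d_x^m d_y^n v of a convex v with unimodular Hessian.  Working with the family
keeps its members expressible as combinations of derivatives of another
function, as they are after a change of variables. *)
Definition unimodular_tower (d : R) (W : nat -> nat -> C -> R) : Prop :=
  (forall m n z, Cmod z < d ->
    has_partials (fun w => RtoC (W m n w)) z (RtoC (W (S m) n z)) (RtoC (W m (S n) z))) /\
  (forall z, Cmod z < d ->
    0 < W 2%nat 0%nat z /\ W 2%nat 0%nat z * W 0%nat 2%nat z - W 1%nat 1%nat z ^ 2 = 1).

Definition grad (W : nat -> nat -> C -> R) (z : C) : C :=
  (W 1%nat 0%nat z - W 1%nat 0%nat 0%C, W 0%nat 1%nat z - W 0%nat 1%nat 0%C).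

(** In the notation of the introduction [lewy] is zeta and [colewy] is F;
[lewy_x], [lewy_y], [colewy_x], [colewy_y] are their partial derivatives and
[slope] is H = dF / dzeta. *)
Definition lewy W (z : C) : C := (z + grad W z)%C.
Definition colewy W (z : C) : C := Cconj (z - grad W z)%C.
Definition lewy_x (W : nat -> nat -> C -> R) (z : C) : C := (1 + W 2%nat 0%nat z, W 1%nat 1%nat z).
Definition lewy_y (W : nat -> nat -> C -> R) (z : C) : C := (W 1%nat 1%nat z, 1 + W 0%nat 2%nat z).
Definition colewy_x (W : nat -> nat -> C -> R) (z : C) : C := (1 - W 2%nat 0%nat z, W 1%nat 1%nat z).
Definition colewy_y (W : nat -> nat -> C -> R) (z : C) : C := (- W 1%nat 1%nat z, W 0%nat 2%nat z - 1).

Definition slope W (z : C) : C := (colewy_x W z / lewy_x W z)%C.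

Definition dot (z w : C) : R := Re z * Re w + Im z * Im w.

Lemma dot_diag z : dot z z = Cmod z ^ 2.
Proof. rewrite Cmod2_alt. unfold dot. ring. Qed.

Lemma dot_le_Cmod z w : dot z w <= Cmod z * Cmod w.
Proof.
replace (dot z w) with (Re (z * Cconj w)) by (unfold dot, Re, Im; simpl; ring).
rewrite <- (Cmod_conj w), <- Cmod_mult.
eapply Rle_trans; [apply Rle_abs|apply re_le_Cmod].
Qed.

Lemma Cmod_segment_lt d z w t :
  Cmod z < d -> Cmod w < d -> 0 <= t <= 1 -> Cmod (z + RtoC t * (w - z)) < d.
Proof.
intros Hz Hw Ht. replace (z + RtoC t * (w - z))%C with (RtoC (1 - t) * z + RtoC t * w)%C.
- eapply Rle_lt_trans; [apply Cmod_triangle|].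
  rewrite !Cmod_mult, !Cmod_R, !Rabs_pos_eq by lra.
  assert (P : (1 - t) * Cmod z <= (1 - t) * Rmax (Cmod z) (Cmod w)) by (apply Rmult_le_compat_l; [lra|apply Rmax_l]).
  assert (Q : t * Cmod w <= t * Rmax (Cmod z) (Cmod w)) by (apply Rmult_le_compat_l; [lra|apply Rmax_r]).
  assert (Rmax (Cmod z) (Cmod w) < d) by now apply Rmax_lub_lt. lra.
- rewrite RtoC_minus. ring.
Qed.

(** The mean value theorem along the segment reduces this to the positivity of
the Hessian form, which follows by completing the square from a positive
diagonal entry and determinant 1. *)
Lemma grad_monotone d W z1 z2 :
  unimodular_tower d W -> Cmod z1 < d -> Cmod z2 < d ->
  0 <= dot (grad W z2 - grad W z1) (z2 - z1).
Proof.
intros [HW HM] H1 H2. set (h := (z2 - z1)%C).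
set (g := fun z : C => (RtoC (W 1%nat 0%nat z) * RtoC (Re h) + RtoC (W 0%nat 1%nat z) * RtoC (Im h))%C).
destruct (MVT_cor2 (fun t => Re (g (z1 + RtoC t * h)%C))
  (fun t => let z := (z1 + RtoC t * h)%C in
     W 2%nat 0%nat z * Re h ^ 2 + 2 * W 1%nat 1%nat z * (Re h * Im h) + W 0%nat 2%nat z * Im h ^ 2) 0 1)
  as [t [Ht Hlt]].
- lra.
- intros t Ht. apply is_derive_Reals. cbv beta zeta.
  assert (Hz : Cmod (z1 + RtoC t * h) < d) by now apply Cmod_segment_lt.
  set (z := (z1 + RtoC t * h)%C) in *.
  replace (W 2%nat 0%nat z * Re h ^ 2 + 2 * W 1%nat 1%nat z * (Re h * Im h) + W 0%nat 2%nat z * Im h ^ 2)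
    with (Re ((RtoC (W 2%nat 0%nat z) * RtoC (Re h) + RtoC (W 1%nat 0%nat z) * 0
               + (RtoC (W 1%nat 1%nat z) * RtoC (Im h) + RtoC (W 0%nat 1%nat z) * 0)) * RtoC (Re h)
            + (RtoC (W 1%nat 1%nat z) * RtoC (Re h) + RtoC (W 1%nat 0%nat z) * 0
               + (RtoC (W 0%nat 2%nat z) * RtoC (Im h) + RtoC (W 0%nat 1%nat z) * 0)) * RtoC (Im h))%C)
    by (simpl; ring).
  apply (has_partials_line g). unfold g.
  apply has_partials_plus; apply has_partials_mult; try apply has_partials_const; now apply HW.
- cbv beta zeta in Ht. replace (z1 + RtoC 1 * h)%C with z2 in Ht by (unfold h; ring).
  replace (z1 + RtoC 0 * h)%C with z1 in Ht by ring.
  assert (Hz : Cmod (z1 + RtoC t * h) < d) by (apply Cmod_segment_lt; auto; lra).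
  set (z := (z1 + RtoC t * h)%C) in *.
  destruct (HM z Hz) as [P D].
  assert (E : dot (grad W z2 - grad W z1) h = Re (g z2) - Re (g z1)).
  { unfold dot, g, grad, Re, Im. simpl. ring. }
  rewrite E, Ht, Rminus_0_r, Rmult_1_r.
  apply (Rmult_le_reg_l (W 2%nat 0%nat z)); [exact P|]. rewrite Rmult_0_r.
  assert (0 <= W 2%nat 0%nat z * (W 2%nat 0%nat z * Re h ^ 2 + 2 * W 1%nat 1%nat z * (Re h * Im h) + W 0%nat 2%nat z * Im h ^ 2)).
  { replace (W 2%nat 0%nat z * (W 2%nat 0%nat z * Re h ^ 2 + 2 * W 1%nat 1%nat z * (Re h * Im h) + W 0%nat 2%nat z * Im h ^ 2))
      with ((W 2%nat 0%nat z * Re h + W 1%nat 1%nat z * Im h) ^ 2 + (W 2%nat 0%nat z * W 0%nat 2%nat z - W 1%nat 1%nat z ^ 2) * Im h ^ 2) by ring.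
    rewrite D. assert (A1 := pow2_ge_0 (W 2%nat 0%nat z * Re h + W 1%nat 1%nat z * Im h)).
    assert (A2 := pow2_ge_0 (Im h)). lra. }
  exact H.
Qed.

Lemma lewy_0 W : lewy W 0%C = 0%C.
Proof. unfold lewy, grad. apply injective_projections; simpl; ring. Qed.

Lemma colewy_0 W : colewy W 0%C = 0%C.
Proof. unfold colewy, grad. apply injective_projections; simpl; ring. Qed.

(** The gradient is monotone, so adding the identity to it gives an expanding
map: take the scalar product of the increment with [z2 - z1]. *)
Lemma lewy_expanding d W z1 z2 :
  unimodular_tower d W -> Cmod z1 < d -> Cmod z2 < d ->
  Cmod (z2 - z1) <= Cmod (lewy W z2 - lewy W z1).
Proof.
intros HW H1 H2. assert (M := grad_monotone d W z1 z2 HW H1 H2).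
assert (L := dot_le_Cmod (lewy W z2 - lewy W z1) (z2 - z1)).
assert (E : dot (lewy W z2 - lewy W z1) (z2 - z1) = Cmod (z2 - z1) ^ 2 + dot (grad W z2 - grad W z1) (z2 - z1)).
{ rewrite <- dot_diag. unfold dot, lewy, Re, Im. simpl. ring. }
assert (P := Cmod_ge_0 (z2 - z1)). assert (Q := Cmod_ge_0 (lewy W z2 - lewy W z1)). 
destruct (Req_dec (Cmod (z2 - z1)) 0) as [Z|Z]; [lra|].
apply (Rmult_le_reg_r (Cmod (z2 - z1))); [lra|]. simpl in E. lra.
Qed.

Lemma derivative_at_left_min (g : R -> R) l :
  is_derive g 0 l -> (forall t, 0 <= t <= 1 -> g 0 <= g t) -> 0 <= l.
Proof.
intros D H. apply Rnot_lt_le. intros L. apply is_derive_Reals in D.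
destruct (D (- l / 2)) as [e K]; [lra|].
assert (He := cond_pos e).
set (t := Rmin (e / 2) 1).
assert (Ht : 0 < t /\ t <= 1 /\ t < e) by (unfold t, Rmin; destruct Rle_dec; lra).
specialize (K t ltac:(lra) ltac:(rewrite Rabs_pos_eq; lra)). rewrite Rplus_0_l in K.
apply Rabs_def2 in K. specialize (H t ltac:(lra)).
assert (0 <= (g t - g 0) / t) by (apply Rdiv_le_0_compat; lra). lra.
Qed.

(** A preimage of [w] is a critical point of th = v + |z|^2 / 2 - <w, z>, up
to the linear part of v at 0.  Minimise th over the disc of radius r.  If the
gradient e = zeta - w did not vanish at the minimiser z0, then z0 would lie on
the circle and e would be a negative multiple of z0.  Since <zeta, z0> >= 0 by
monotonicity, this gives |w| = |zeta - e| >= |zeta|, against the hypothesis. *)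
Lemma lewy_onto d W r w :
  unimodular_tower d W -> 0 < r < d ->
  (forall z, Cmod z = r -> Cmod w < Cmod (lewy W z)) ->
  exists z, Cmod z < d /\ lewy W z = w.
Proof.
intros HW Hr Hw. assert (HT := proj1 HW).
set (c := ((W 1%nat 0%nat 0%C, W 0%nat 1%nat 0%C) + w : C)%C).
set (th := fun z : C => (RtoC (W 0%nat 0%nat z) + (- RtoC (Re c) * RtoC (Re z) + - RtoC (Im c) * RtoC (Im z))
   + RtoC (/ 2) * (RtoC (Re z) * RtoC (Re z) + RtoC (Im z) * RtoC (Im z)))%C).
assert (Dth : forall z, Cmod z < d -> has_partials th z (RtoC (Re (lewy W z - w))) (RtoC (Im (lewy W z - w)))).
{ intros z Hz.
  replace (RtoC (Re (lewy W z - w))) with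
    (RtoC (W 1%nat 0%nat z) + (- RtoC (Re c) * 1 + - RtoC (Im c) * 0)
      + RtoC (/ 2) * ((1 * RtoC (Re z) + RtoC (Re z) * 1) + (0 * RtoC (Im z) + RtoC (Im z) * 0)))%C
    by (apply injective_projections; unfold lewy, grad, c, Re, Im; simpl; field).
  replace (RtoC (Im (lewy W z - w))) with
    (RtoC (W 0%nat 1%nat z) + (- RtoC (Re c) * 0 + - RtoC (Im c) * 1)
      + RtoC (/ 2) * ((0 * RtoC (Re z) + RtoC (Re z) * 0) + (1 * RtoC (Im z) + RtoC (Im z) * 1)))%C
    by (apply injective_projections; unfold lewy, grad, c, Re, Im; simpl; field).
  assert (X := has_partials_Re z). assert (Y := has_partials_Im z).
  exact (has_partials_plus _ _ _ _ _ _ _ (has_partials_plus _ _ _ _ _ _ _ (HT _ _ z Hz)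
      (has_partials_plus _ _ _ _ _ _ _ (has_partials_scal _ _ _ _ _ X) (has_partials_scal _ _ _ _ _ Y)))
    (has_partials_scal _ _ _ _ _ (has_partials_plus _ _ _ _ _ _ _
       (has_partials_mult _ _ _ _ _ _ _ X X) (has_partials_mult _ _ _ _ _ _ _ Y Y)))). }
destruct (max_on_compact (fun z => Cmod z <= r) (fun z => Re (- (1) * th z)) r) as [z0 [Hz0 Hmin]].
- exists 0%C. rewrite Cmod_0. lra.
- auto.
- intros z Hz. apply Rnot_le_lt in Hz.
  generalize (continuous_Cmod z _ (open_gt r _ Hz)). unfold filtermap. apply filter_imp. intros v Hv Hv'. lra.
- intros z Hz. apply (continuous_comp (U := C_UniformSpace) (fun z => - (1) * th z)%C Re).
  + eapply has_partials_continuous. apply has_partials_mult; [apply has_partials_const|apply Dth; lra].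
  + apply (continuous_fst (U := R_UniformSpace)).
- assert (Hmin' : forall z, Cmod z <= r -> Re (th z0) <= Re (th z)).
  { intros z Hz. specialize (Hmin z Hz).
    replace (Re (- (1) * th z)) with (- Re (th z)) in Hmin by (unfold Re, Im; simpl; ring).
    replace (Re (- (1) * th z0)) with (- Re (th z0)) in Hmin by (unfold Re, Im; simpl; ring). lra. }
  clear Hmin.
  set (e := (lewy W z0 - w)%C) in *.
  assert (Opt : forall v, Cmod v <= r -> 0 <= dot e (v - z0)).
  { intros v Hv. apply (derivative_at_left_min (fun t => Re (th (z0 + RtoC t * (v - z0))%C))).
    - replace (dot e (v - z0)) with (Re (RtoC (Re e) * RtoC (Re (v - z0)) + RtoC (Im e) * RtoC (Im (v - z0)))%C)
        by (unfold dot; simpl; ring).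
      apply has_partials_line. replace (z0 + RtoC 0 * (v - z0))%C with z0 by ring. apply Dth. lra.
    - intros t Ht. replace (z0 + RtoC 0 * (v - z0))%C with z0 by ring. apply Hmin'.
      apply Rnot_lt_le. intros L.
      destruct (Rle_lt_dec (Cmod (z0 + RtoC t * (v - z0))) r); [lra|].
      assert (X := Cmod_segment_lt (Cmod (z0 + RtoC t * (v - z0))) z0 v t ltac:(lra) ltac:(lra) Ht). lra. }
  exists z0. split; [lra|].
  destruct (Req_dec (Cmod e) 0) as [E|N].
  { apply Cmod_eq_0 in E. replace (lewy W z0) with (e + w)%C by (unfold e; ring). rewrite E. ring. }
  exfalso. assert (Pe := Cmod_ge_0 e).
  (* compare with the point of the disc where the linear form [dot e] is least *)
  set (s := Cmod e) in *.
  assert (Opt1 := Opt (RtoC (- r / s) * e)%C).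
  rewrite Cmod_mult, Cmod_R in Opt1. fold s in Opt1.
  assert (Rabs (- r / s) * s <= r).
  { unfold Rdiv. rewrite Rabs_mult, Rabs_Ropp, Rabs_inv, (Rabs_pos_eq r), (Rabs_pos_eq s) by lra.
    right. field. exact N. }
  specialize (Opt1 H).
  assert (E1 : dot e (RtoC (- r / s) * e - z0) = - r * s - dot e z0).
  { assert (Es : dot e e = s ^ 2) by apply dot_diag.
    replace (dot e (RtoC (- r / s) * e - z0)) with (- r / s * dot e e - dot e z0)
      by (unfold dot, Re, Im; simpl; ring).
    rewrite Es. field. exact N. }
  rewrite E1 in Opt1.
  assert (Es : Re e ^ 2 + Im e ^ 2 = s ^ 2) by (unfold s; now rewrite Cmod2_alt).
  assert (Ez : Re z0 ^ 2 + Im z0 ^ 2 <= r ^ 2).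
  { rewrite <- Cmod2_alt. apply pow_incr. split; [apply Cmod_ge_0|exact Hz0]. }
  assert (Hmono := grad_monotone d W 0%C z0 HW ltac:(rewrite Cmod_0; lra) ltac:(lra)).
  assert (Hl : 0 <= dot (lewy W z0) z0).
  { replace (dot (lewy W z0) z0) with (dot z0 z0 + dot (grad W z0 - grad W 0) (z0 - 0))
      by (unfold dot, lewy, grad, Re, Im; simpl; ring).
    rewrite dot_diag. assert (X := pow2_ge_0 (Cmod z0)). lra. }
  assert (Z : (r * Re e + s * Re z0) ^ 2 + (r * Im e + s * Im z0) ^ 2 <= 0).
  { replace ((r * Re e + s * Re z0) ^ 2 + (r * Im e + s * Im z0) ^ 2) with
      (r ^ 2 * (Re e ^ 2 + Im e ^ 2) + 2 * (r * s) * dot e z0 + s ^ 2 * (Re z0 ^ 2 + Im z0 ^ 2))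
      by (unfold dot; ring).
    rewrite Es.
    assert (r * s * dot e z0 <= r * s * (- r * s)) by (apply Rmult_le_compat_l; [apply Rmult_le_pos; lra|lra]).
    assert (s ^ 2 * (Re z0 ^ 2 + Im z0 ^ 2) <= s ^ 2 * r ^ 2) by (apply Rmult_le_compat_l; [apply pow2_ge_0|exact Ez]).
    lra. }
  assert (Z1 := pow2_ge_0 (r * Re e + s * Re z0)). assert (Z2 := pow2_ge_0 (r * Im e + s * Im z0)).
  assert (Y1 : r * Re e + s * Re z0 = 0) by (apply Rsqr_0_uniq; rewrite Rsqr_pow2; lra).
  assert (Y2 : r * Im e + s * Im z0 = 0) by (apply Rsqr_0_uniq; rewrite Rsqr_pow2; lra).
  assert (Ez' : Cmod z0 = r).
  { assert (X : (s * Cmod z0) ^ 2 = (s * r) ^ 2).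
    { rewrite (Rpow_mult_distr s (Cmod z0)), Cmod2_alt.
      replace (s ^ 2 * (Re z0 ^ 2 + Im z0 ^ 2)) with ((s * Re z0) ^ 2 + (s * Im z0) ^ 2) by ring.
      replace ((s * r) ^ 2) with ((r * Re e) ^ 2 + (r * Im e) ^ 2) by (rewrite (Rpow_mult_distr s r), <- Es; ring).
      replace (s * Re z0) with (- (r * Re e)) by lra. replace (s * Im z0) with (- (r * Im e)) by lra. ring. }
    assert (Pz := Cmod_ge_0 z0).
    rewrite <- !Rsqr_pow2 in X. apply Rsqr_inj in X; [|apply Rmult_le_pos; lra|apply Rmult_le_pos; lra].
    apply Rmult_eq_reg_l in X; [exact X|exact N]. }
  specialize (Hw z0 Ez').
  assert (Ew : Cmod w ^ 2 = Cmod (lewy W z0) ^ 2 - 2 * dot (lewy W z0) e + s ^ 2).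
  { rewrite <- Es, !Cmod2_alt. replace w with (lewy W z0 - e)%C at 1 2 by (unfold e; ring).
    unfold dot, Re, Im. simpl. ring. }
  assert (Er : r * dot (lewy W z0) e <= 0).
  { replace (r * dot (lewy W z0) e) with (- s * dot (lewy W z0) z0).
    - assert (0 <= s * dot (lewy W z0) z0) by (apply Rmult_le_pos; lra). lra.
    - unfold dot. 
      replace (r * (Re (lewy W z0) * Re e + Im (lewy W z0) * Im e)) with
        (Re (lewy W z0) * (r * Re e) + Im (lewy W z0) * (r * Im e)) by ring.
      replace (r * Re e) with (- (s * Re z0)) by lra. replace (r * Im e) with (- (s * Im z0)) by lra. ring. }
  assert (dot (lewy W z0) e <= 0) by nra.
  assert (P1 := Cmod_ge_0 w). assert (P2 := pow2_ge_0 s).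
  assert (Cmod w ^ 2 < Cmod (lewy W z0) ^ 2) by nra.
  lra.
Qed.

(** * Holomorphy of the slope *)

Definition partials_on (d : R) (f fx fy : C -> C) : Prop :=
  forall z, Cmod z < d -> has_partials f z (fx z) (fy z).

(** The complex derivative of a holomorphic function is holomorphic.  Here
[X], [Y] are the partial derivatives of the coordinate zeta and [A], [B] those
of a function f with [A * Y = B * X], that is df = (A / X) dzeta.
Differentiating this relation in x, and using the symmetry of the second
derivatives, shows that A / X satisfies it too. *)
Lemma CR_quotient d X Xx Xy Y Yy A Ax Ay B By :
  partials_on d X Xx Xy -> partials_on d Y Xy Yy ->
  partials_on d A Ax Ay -> partials_on d B Ay By ->
  (forall z, Cmod z < d -> X z <> 0%C) ->
  (forall z, Cmod z < d -> (A z * Y z = B z * X z)%C) ->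
  forall z, Cmod z < d ->
    ((Ax z - A z / X z * Xx z) / X z * Y z = (Ay z - A z / X z * Xy z) / X z * X z)%C.
Proof.
intros HX HY HA HB NX CR z Hz.
assert (D1 := has_partials_mult _ _ _ _ _ _ _ (HA z Hz) (HY z Hz)).
assert (D2 := has_partials_mult _ _ _ _ _ _ _ (HB z Hz) (HX z Hz)).
assert (D3 : has_partials (fun w => A w * Y w)%C z
   (Ay z * X z + B z * Xx z)%C (By z * X z + B z * Xy z)%C).
{ refine (has_partials_ext_loc _ _ _ _ _ _ D2). exists (d - Cmod z). split; [lra|].
  intros w Hw. symmetry. apply CR. assert (T := Cmod_sub_triangle w z). lra. }
destruct (has_partials_unique _ _ _ _ _ _ D1 D3) as [E _].
specialize (NX z Hz). specialize (CR z Hz).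
assert (EB : B z = (A z * Y z / X z)%C) by (rewrite CR; field; exact NX).
assert (EA : (Ax z * Y z)%C = (Ay z * X z + B z * Xx z - A z * Xy z)%C) by (rewrite <- E; ring).
replace ((Ax z - A z / X z * Xx z) / X z * Y z)%C with ((Ax z * Y z - A z / X z * Xx z * Y z) / X z)%C
  by (field; exact NX).
rewrite EA, EB. field. exact NX.
Qed.

Definition scaled_pair (s1 s2 : R) (f1 f2 : C -> R) (z : C) : C := (s1 * f1 z, s2 * f2 z).

Lemma scaled_pair_partials d W m n m' n' s1 s2 :
  unimodular_tower d W ->
  partials_on d (scaled_pair s1 s2 (W m n) (W m' n'))
    (scaled_pair s1 s2 (W (S m) n) (W (S m') n')) (scaled_pair s1 s2 (W m (S n)) (W m' (S n'))).
Proof.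
intros [HW _] z Hz.
refine (has_partials_ext _ _ _ _ _ _
  (has_partials_affine_pair _ _ _ _ _ _ _ 0 s1 0 s2 (HW m n z Hz) (HW m' n' z Hz))).
intros w. unfold scaled_pair. now rewrite !Rplus_0_l.
Qed.

Lemma lewy_x_neq_0 d W z : unimodular_tower d W -> Cmod z < d -> lewy_x W z <> 0%C.
Proof.
intros [_ HM] Hz. destruct (HM z Hz) as [P _]. apply C_neq_0_iff_sqr. unfold lewy_x, Re, Im. simpl.
assert (X := pow2_ge_0 (W 1%nat 1%nat z)). nra.
Qed.

(** |1 + W_20 + i W_11|^2 - |1 - W_20 + i W_11|^2 = 4 W_20 > 0. *)
Lemma slope_lt_1 d W z : unimodular_tower d W -> Cmod z < d -> Cmod (slope W z) < 1.
Proof.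
intros HW Hz. assert (N := lewy_x_neq_0 d W z HW Hz). destruct HW as [_ HM]. destruct (HM z Hz) as [P _].
unfold slope. rewrite Cmod_div by exact N. apply Cmod_gt_0 in N.
apply Rlt_div_l; [exact N|]. rewrite Rmult_1_l.
apply Rsqr_incrst_0; [|apply Cmod_ge_0|apply Cmod_ge_0].
rewrite !Rsqr_pow2, !Cmod2_alt. unfold lewy_x, colewy_x, Re, Im. simpl. nra.
Qed.

Lemma lewy_partials d W : unimodular_tower d W ->
  partials_on d (lewy W) (lewy_x W) (lewy_y W).
Proof.
intros HW z Hz.
assert (H := has_partials_plus _ _ _ _ _ _ _
  (has_partials_pair _ _ _ _ _ _ _ (has_partials_Re z) (has_partials_Im z))
  (has_partials_affine_pair _ _ _ _ _ _ _ (- W 1%nat 0%nat 0%C) 1 (- W 0%nat 1%nat 0%C) 1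
     (proj1 HW 1%nat 0%nat z Hz) (proj1 HW 0%nat 1%nat z Hz))).
match type of H with has_partials _ _ ?u ?v =>
  replace u with (lewy_x W z) in H; [replace v with (lewy_y W z) in H|] end.
- refine (has_partials_ext _ _ _ _ _ _ H). intros w.
  apply injective_projections; unfold lewy, grad, Re, Im; simpl; ring.
- apply injective_projections; unfold lewy_y; simpl; ring.
- apply injective_projections; unfold lewy_x; simpl; ring.
Qed.

Lemma colewy_partials d W : unimodular_tower d W ->
  partials_on d (colewy W) (colewy_x W) (colewy_y W).
Proof.
intros HW z Hz.
assert (H := has_partials_plus _ _ _ _ _ _ _
  (has_partials_affine_pair _ _ _ _ _ _ _ 0 1 0 (-1) (has_partials_Re z) (has_partials_Im z))
  (has_partials_affine_pair _ _ _ _ _ _ _ (W 1%nat 0%nat 0%C) (-1) (- W 0%nat 1%nat 0%C) 1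
     (proj1 HW 1%nat 0%nat z Hz) (proj1 HW 0%nat 1%nat z Hz))).
match type of H with has_partials _ _ ?u ?v =>
  replace u with (colewy_x W z) in H; [replace v with (colewy_y W z) in H|] end.
- refine (has_partials_ext _ _ _ _ _ _ H). intros w.
  apply injective_projections; unfold colewy, grad, Re, Im; simpl; ring.
- apply injective_projections; unfold colewy_y; simpl; ring.
- apply injective_projections; unfold colewy_x; simpl; ring.
Qed.

(** With respect to zeta, [colewy W], [slope W] and [h1] are holomorphic with
derivatives [slope W], [h1] and [h2]: in each line the two partial derivatives
are a common factor times those of zeta.  The Cauchy-Riemann relation is
checked for [colewy W] from the Monge-Ampere equation and propagates by
[CR_quotient].  The maximum principle asks for two derivatives of the slope. *)
Lemma slope_chain d W : unimodular_tower d W ->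
  exists h1 h2 : C -> C, forall z, Cmod z < d ->
    has_partials (colewy W) z (slope W z * lewy_x W z)%C (slope W z * lewy_y W z)%C /\
    has_partials (slope W) z (h1 z * lewy_x W z)%C (h1 z * lewy_y W z)%C /\
    has_partials h1 z (h2 z * lewy_x W z)%C (h2 z * lewy_y W z)%C /\
    h1 z = ((scaled_pair (-1) 1 (W 3%nat 0%nat) (W 2%nat 1%nat) z
              - slope W z * scaled_pair 1 1 (W 3%nat 0%nat) (W 2%nat 1%nat) z) / (lewy_x W z * lewy_x W z))%C.
Proof.
intros HW.
set (X := lewy_x W). set (Y := lewy_y W). set (A := colewy_x W). set (B := colewy_y W).
set (Xx := scaled_pair 1 1 (W 3%nat 0%nat) (W 2%nat 1%nat)).
set (Xy := scaled_pair 1 1 (W 2%nat 1%nat) (W 1%nat 2%nat)).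
set (Yy := scaled_pair 1 1 (W 1%nat 2%nat) (W 0%nat 3%nat)).
set (Ax := scaled_pair (-1) 1 (W 3%nat 0%nat) (W 2%nat 1%nat)).
set (Ay := scaled_pair (-1) 1 (W 2%nat 1%nat) (W 1%nat 2%nat)).
set (By := scaled_pair (-1) 1 (W 1%nat 2%nat) (W 0%nat 3%nat)).
assert (T : forall m n m' n' c1 s1 c2 s2 z, Cmod z < d ->
  has_partials (fun w => (c1 + s1 * W m n w, c2 + s2 * W m' n' w) : C) z
   (scaled_pair s1 s2 (W (S m) n) (W (S m') n') z) (scaled_pair s1 s2 (W m (S n)) (W m' (S n')) z)).
{ intros. apply has_partials_affine_pair; now apply HW. }
assert (HX : partials_on d X Xx Xy).
{ intros z Hz. refine (has_partials_ext _ _ _ _ _ _ (T 2%nat 0%nat 1%nat 1%nat 1 1 0 1 z Hz)).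
  intros w. apply injective_projections; unfold X, lewy_x; simpl; ring. }
assert (HY : partials_on d Y Xy Yy).
{ intros z Hz. refine (has_partials_ext _ _ _ _ _ _ (T 1%nat 1%nat 0%nat 2%nat 0 1 1 1 z Hz)).
  intros w. apply injective_projections; unfold Y, lewy_y; simpl; ring. }
assert (HA : partials_on d A Ax Ay).
{ intros z Hz. refine (has_partials_ext _ _ _ _ _ _ (T 2%nat 0%nat 1%nat 1%nat 1 (-1) 0 1 z Hz)).
  intros w. apply injective_projections; unfold A, colewy_x; simpl; ring. }
assert (HB : partials_on d B Ay By).
{ intros z Hz. refine (has_partials_ext _ _ _ _ _ _ (T 1%nat 1%nat 0%nat 2%nat 0 (-1) (-1) 1 z Hz)).
  intros w. apply injective_projections; unfold B, colewy_y; simpl; ring. }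
assert (NX : forall z, Cmod z < d -> X z <> 0%C) by (intros; now apply lewy_x_neq_0 with d).
(* the Monge-Ampere equation is the Cauchy-Riemann equation of the co-Lewy map *)
assert (CR : forall z, Cmod z < d -> (A z * Y z = B z * X z)%C).
{ intros z Hz. destruct (proj2 HW z Hz) as [_ D].
  apply injective_projections; unfold A, B, X, Y, lewy_x, lewy_y, colewy_x, colewy_y; simpl; nra. }
set (h := slope W).
set (hx := fun z => ((Ax z - h z * Xx z) / X z)%C).
set (hy := fun z => ((Ay z - h z * Xy z) / X z)%C).
assert (Hh : partials_on d h hx hy).
{ intros z Hz. exact (has_partials_div _ _ _ _ _ _ _ (HA z Hz) (HX z Hz) (NX z Hz)). }
assert (CRh : forall z, Cmod z < d -> (hx z * Y z = hy z * X z)%C).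
{ exact (CR_quotient d X Xx Xy Y Yy A Ax Ay B By HX HY HA HB NX CR). }
assert (Sub : forall f g z a b a' b', has_partials f z a b -> has_partials g z a' b' ->
   has_partials (fun w => f w - g w)%C z (a - a')%C (b - b')%C).
{ intros f g z a b a' b' Hf Hg.
  assert (H := has_partials_plus _ _ _ _ _ _ _ Hf (has_partials_scal (- (1))%C _ _ _ _ Hg)).
  replace (a - a')%C with (a + - (1) * a')%C by ring. replace (b - b')%C with (b + - (1) * b')%C by ring.
  refine (has_partials_ext _ _ _ _ _ _ H). intros w. ring. }
set (Xxx := scaled_pair 1 1 (W 4%nat 0%nat) (W 3%nat 1%nat)).
set (Xxy := scaled_pair 1 1 (W 3%nat 1%nat) (W 2%nat 2%nat)).
set (Xyy := scaled_pair 1 1 (W 2%nat 2%nat) (W 1%nat 3%nat)).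
set (Axx := scaled_pair (-1) 1 (W 4%nat 0%nat) (W 3%nat 1%nat)).
set (Axy := scaled_pair (-1) 1 (W 3%nat 1%nat) (W 2%nat 2%nat)).
set (Ayy := scaled_pair (-1) 1 (W 2%nat 2%nat) (W 1%nat 3%nat)).
set (hxx := fun z => ((Axx z - (hx z * Xx z + h z * Xxx z) - hx z * Xx z) / X z)%C).
set (hxy := fun z => ((Axy z - (hy z * Xx z + h z * Xxy z) - hx z * Xy z) / X z)%C).
set (hyy := fun z => ((Ayy z - (hy z * Xy z + h z * Xyy z) - hy z * Xy z) / X z)%C).
assert (Hhx : partials_on d hx hxx hxy).
{ intros z Hz.
  exact (has_partials_div _ _ _ _ _ _ _ (Sub _ _ _ _ _ _ _ (scaled_pair_partials d W 3%nat 0%nat 2%nat 1%nat (-1) 1 HW z Hz)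
    (has_partials_mult _ _ _ _ _ _ _ (Hh z Hz) (scaled_pair_partials d W 3%nat 0%nat 2%nat 1%nat 1 1 HW z Hz)))
    (HX z Hz) (NX z Hz)). }
assert (Hhy : partials_on d hy hxy hyy).
{ intros z Hz.
  replace (hxy z) with ((Axy z - (hx z * Xy z + h z * Xxy z) - hy z * Xx z) / X z)%C by (unfold hxy; f_equal; ring).
  exact (has_partials_div _ _ _ _ _ _ _ (Sub _ _ _ _ _ _ _ (scaled_pair_partials d W 2%nat 1%nat 1%nat 2%nat (-1) 1 HW z Hz)
    (has_partials_mult _ _ _ _ _ _ _ (Hh z Hz) (scaled_pair_partials d W 2%nat 1%nat 1%nat 2%nat 1 1 HW z Hz)))
    (HX z Hz) (NX z Hz)). }
set (h1 := fun z => (hx z / X z)%C).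
set (h1x := fun z => ((hxx z - h1 z * Xx z) / X z)%C).
set (h1y := fun z => ((hxy z - h1 z * Xy z) / X z)%C).
assert (CRh1 : forall z, Cmod z < d -> (h1x z * Y z = h1y z * X z)%C).
{ exact (CR_quotient d X Xx Xy Y Yy hx hxx hxy hy hyy HX HY Hhx Hhy NX CRh). }
assert (Split : forall f a b z, Cmod z < d -> (a * Y z = b * X z)%C ->
  has_partials f z a b -> has_partials f z (a / X z * X z)%C (a / X z * Y z)%C).
{ intros f a b z Hz E H. specialize (NX z Hz).
  replace (a / X z * X z)%C with a by (field; exact NX).
  replace (a / X z * Y z)%C with (a * Y z / X z)%C by (field; exact NX).
  rewrite E. replace (b * X z / X z)%C with b by (field; exact NX). exact H. }
exists h1, (fun z => (h1x z / X z)%C). intros z Hz.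
split; [|split; [|split]].
- apply (Split _ _ (B z)); [exact Hz|now apply CR|]. now apply (colewy_partials d W HW).
- apply (Split _ _ (hy z)); [exact Hz|now apply CRh|]. now apply Hh.
- apply (Split _ _ (h1y z)); [exact Hz|now apply CRh1|].
  exact (has_partials_div _ _ _ _ _ _ _ (Hhx z Hz) (HX z Hz) (NX z Hz)).
- unfold h1, hx, h. fold X Ax Xx. field. now apply NX.
Qed.

(** * The normalised solution *)

Definition normalised (W : nat -> nat -> C -> R) : Prop :=
  W 2%nat 0%nat 0%C = 1 /\ W 1%nat 1%nat 0%C = 0 /\ W 0%nat 2%nat 0%C = 1.

(** Recovers z from zeta and F, as (zeta + conj F) / 2. *)
Lemma lewy_colewy W z : z = ((lewy W z + Cconj (colewy W z)) * RtoC (/ 2))%C.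
Proof.
unfold lewy, colewy. apply injective_projections; simpl; field.
Qed.

(** On a disc covered by zeta, [inv] is its inverse and [f], [f1], [f2] are
the first three derivatives of F as a function of zeta.  At 0 one has H = 0,
d zeta / dx = 2 and dH / dx = (- v_30 + i v_21) / 2, whence the value of
|F''(0)|. *)
Lemma lewy_chart d W rho :
  unimodular_tower d W -> normalised W -> 0 < d -> 0 < rho ->
  (forall w, Cmod w < rho -> exists z, Cmod z < d /\ lewy W z = w) ->
  exists inv f f1 f2 : C -> C,
    f 0%C = 0%C /\ colewy W (inv 0%C) = 0%C /\
    Cmod (f1 0%C) ^ 2 = (W 3%nat 0%nat 0%C ^ 2 + W 2%nat 1%nat 0%C ^ 2) / 16 /\
    forall w, Cmod w < rho ->
      Cmod (inv w) < d /\ lewy W (inv w) = w /\ f w = slope W (inv w) /\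
      has_cderiv (fun v => colewy W (inv v)) w (f w) /\
      has_cderiv f w (f1 w) /\ has_cderiv f1 w (f2 w).
Proof.
intros HW HN Hd Hrho Honto.
set (inv := fun w => epsilon (inhabits (RtoC 0)) (fun z => Cmod z < d /\ lewy W z = w)).
assert (Hinv : forall w, Cmod w < rho -> Cmod (inv w) < d /\ lewy W (inv w) = w).
{ intros w Hw. exact (epsilon_spec (inhabits (RtoC 0)) _ (Honto w Hw)). }
assert (Hinj : forall z w, Cmod z < d -> Cmod w < d -> lewy W z = lewy W w -> z = w).
{ intros z w Hz Hw E. assert (L := lewy_expanding d W w z HW Hw Hz).
  rewrite E in L. replace (lewy W w - lewy W w)%C with (RtoC 0) in L by ring. rewrite Cmod_0 in L.
  assert (P := Cmod_ge_0 (z - w)). replace z with ((z - w) + w)%C by ring.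
  rewrite (Cmod_eq_0 (z - w)) by lra. ring. }
assert (inv0 : inv 0%C = 0%C).
{ destruct (Hinv 0%C) as [H1 H2]; [rewrite Cmod_0; exact Hrho|].
  apply Hinj; [exact H1|rewrite Cmod_0; exact Hd|]. now rewrite H2, lewy_0. }
destruct (slope_chain d W HW) as [h1 [h2 Hh]].
exists inv, (fun w => slope W (inv w)), (fun w => h1 (inv w)), (fun w => h2 (inv w)).
assert (Cmod00 : Cmod 0 < d) by (rewrite Cmod_0; exact Hd).
destruct HN as [N20 [N11 N02]].
assert (slope0 : slope W 0%C = 0%C).
{ unfold slope. replace (colewy_x W 0%C) with (RtoC 0); [unfold Cdiv; ring|].
  apply injective_projections; unfold colewy_x; simpl; rewrite ?N20, ?N11; ring. }
split; [now rewrite inv0|]. split; [rewrite inv0; apply colewy_0|]. split.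
- rewrite inv0. destruct (Hh 0%C Cmod00) as [_ [_ [_ ->]]]. rewrite slope0.
  assert (NX := lewy_x_neq_0 d W 0%C HW Cmod00).
  assert (EX : lewy_x W 0%C = RtoC 2).
  { apply injective_projections; unfold lewy_x; simpl; rewrite ?N20, ?N11; ring. }
  rewrite Cmod_div by (rewrite EX in *; now apply Cmult_neq_0).
  rewrite Cmod_mult, EX, Cmod_R, Rabs_pos_eq by lra.
  match goal with |- (Cmod ?e / _) ^ 2 = _ => replace e with (scaled_pair (-1) 1 (W 3%nat 0%nat) (W 2%nat 1%nat) 0%C) by ring end.
  unfold Rdiv. rewrite Rpow_mult_distr, Cmod2_alt. unfold scaled_pair, Re, Im. simpl. field.
- intros w Hw. destruct (Hinv w Hw) as [I1 I2].
  split; [exact I1|]. split; [exact I2|]. split; [reflexivity|].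
  assert (Hloc : exists delta, 0 < delta /\ forall v, Cmod (v - w) < delta ->
     lewy W (inv v) = v /\ Cmod (inv v - inv w) <= Cmod (v - w)).
  { exists (rho - Cmod w). split; [lra|]. intros v Hv.
    assert (T := Cmod_sub_triangle v w). destruct (Hinv v ltac:(lra)) as [J1 J2].
    split; [exact J2|]. assert (L := lewy_expanding d W (inv w) (inv v) HW I1 J1).
    now rewrite I2, J2 in L. }
  assert (HL := lewy_partials d W HW (inv w) I1).
  destruct (Hh (inv w) I1) as [D0 [D1 [D2 _]]].
  split; [|split]; eapply has_cderiv_inverse; eassumption.
Qed.

(** The Schwarz lemma for f = F', integrated from 0. *)
Lemma chart_colewy_bound (rho : R) (F f f1 f2 : C -> C) :
  0 < rho -> F 0%C = 0%C -> f 0%C = 0%C ->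
  (forall w, Cmod w < rho -> has_cderiv F w (f w) /\ has_cderiv f w (f1 w) /\ has_cderiv f1 w (f2 w)) ->
  (forall w, Cmod w < rho -> Cmod (f w) <= 1) ->
  forall w, Cmod w < rho -> Cmod (F w) <= Cmod w ^ 2 / (2 * rho).
Proof.
intros Hrho F0 f0 HD Hf w Hw.
replace (Cmod w ^ 2 / (2 * rho)) with (/ rho * Cmod w ^ 2 / 2) by (field; lra).
apply (primitive_bound rho (/ rho) F f F0); [intros; now apply HD| |exact Hw].
intros z Hz.
destruct (HD 0%C) as [_ [D _]]; [rewrite Cmod_0; exact Hrho|].
destruct (has_partials_Lipschitz _ _ _ _ D) as [M [k [HM [Hk K]]]].
destruct (Req_dec (Cmod z) 0) as [E|N].
- rewrite (Cmod_eq_0 _ E), f0, Cmod_0. lra.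
- assert (P := Cmod_ge_0 z).
  replace (/ rho * Cmod z) with (Cmod z / rho) by (field; lra).
  apply (Schwarz_lemma rho M k f f1 f2 Hk); [| | |lra].
  + intros v Hv. now apply HD.
  + intros v Hv. now apply Hf.
  + intros v Hv. replace (f v) with (f v - f 0%C)%C by (rewrite f0; ring).
    replace (Cmod v) with (Cmod (v - 0)) by (f_equal; ring).
    apply K. replace (v - 0)%C with v by ring. apply Hv.
Qed.

(** Let rho be the least value of |zeta| on the circle |z| = r, attained at
z0.  The disc of radius rho is covered, and on it
|z| <= (|zeta| + |zeta|^2 / (2 rho)) / 2 <= 3 rho / 4.  The point z0 is a limit
of preimages of points of this disc, so r <= 3 rho / 4. *)
Lemma lewy_circle d W r z :
  unimodular_tower d W -> normalised W -> 0 < r < d -> Cmod z = r -> 4 / 3 * r <= Cmod (lewy W z).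
Proof.
intros HW HN Hr Hz.
destruct (max_on_compact (fun v => Cmod v = r) (fun v => - Cmod (lewy W v)) r) as [z0 [Hz0 Hmin]].
- exists z. exact Hz.
- intros v Hv. lra.
- intros v Hv. destruct (Rlt_le_dec (Cmod v) r) as [L|L].
  + generalize (continuous_Cmod v _ (open_lt r _ L)). unfold filtermap. apply filter_imp. intros u Hu. lra.
  + assert (L' : r < Cmod v) by lra.
    generalize (continuous_Cmod v _ (open_gt r _ L')). unfold filtermap. apply filter_imp. intros u Hu. lra.
- intros v Hv. apply (continuous_opp (V := R_NormedModule)).
  apply (continuous_comp (U := C_UniformSpace) (lewy W) Cmod); [|apply continuous_Cmod].
  eapply has_partials_continuous. apply (lewy_partials d W HW). lra.
- set (rho := Cmod (lewy W z0)).
  assert (Hrho : 0 < rho).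
  { assert (L := lewy_expanding d W 0%C z0 HW ltac:(rewrite Cmod_0; lra) ltac:(lra)).
    rewrite lewy_0 in L. replace (z0 - 0)%C with z0 in L by ring.
    replace (lewy W z0 - 0)%C with (lewy W z0) in L by ring. unfold rho. lra. }
  apply Rle_trans with rho; [|specialize (Hmin z Hz); unfold rho; lra].
  destruct (lewy_chart d W rho HW HN ltac:(lra) Hrho) as [inv [f [f1 [f2 [f0 [F0 [_ HC]]]]]]].
  { intros w Hw. apply (lewy_onto d W r w HW Hr). intros v Hv. specialize (Hmin v Hv). unfold rho in Hw. lra. }
  assert (HF : forall w, Cmod w < rho -> Cmod (colewy W (inv w)) <= Cmod w ^ 2 / (2 * rho)).
  { apply (chart_colewy_bound rho (fun w => colewy W (inv w)) f f1 f2 Hrho F0 f0).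
    - intros w Hw. destruct (HC w Hw) as [_ [_ [_ H]]]. exact H.
    - intros w Hw. destruct (HC w Hw) as [I1 [_ [-> _]]]. left. now apply slope_lt_1 with d. }
  assert (Key : forall e, 0 < e -> r <= 3 / 4 * rho + e).
  { intros e He.
    set (t := Rmax 0 (1 - e / (2 * rho))).
    assert (He' : 0 < e / (2 * rho)) by (apply Rdiv_lt_0_compat; lra).
    assert (Ht : 0 <= t < 1 /\ 1 - e / (2 * rho) <= t).
    { unfold t, Rmax. destruct Rle_dec; lra. }
    destruct Ht as [Ht Ht'].
    set (w := (RtoC t * lewy W z0)%C).
    assert (Ew : Cmod w = t * rho) by (unfold w; rewrite Cmod_mult, Cmod_R, Rabs_pos_eq by lra; reflexivity).
    assert (Hw : Cmod w < rho) by (rewrite Ew; nra).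
    destruct (HC w Hw) as [I1 [I2 _]]. specialize (HF w Hw). rewrite Ew in HF.
    assert (L := lewy_expanding d W (inv w) z0 HW I1 ltac:(lra)). rewrite I2 in L.
    replace (lewy W z0 - w)%C with (RtoC (1 - t) * lewy W z0)%C in L by (unfold w; rewrite RtoC_minus; ring).
    rewrite Cmod_mult, Cmod_R, Rabs_pos_eq in L by lra. fold rho in L.
    assert (B : Cmod (inv w) <= (rho + rho / 2) / 2).
    { rewrite (lewy_colewy W (inv w)), I2, Cmod_mult, Cmod_R, Rabs_pos_eq by lra.
      assert (T := Cmod_triangle w (Cconj (colewy W (inv w)))). rewrite Cmod_conj in T.
      assert ((t * rho) ^ 2 / (2 * rho) <= rho / 2).
      { replace ((t * rho) ^ 2 / (2 * rho)) with (t ^ 2 * (rho / 2)) by (field; lra). nra. }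
      lra. }
    assert (T := Cmod_sub_triangle z0 (inv w)).
    assert ((1 - t) * rho <= e / 2).
    { apply Rle_trans with (e / (2 * rho) * rho); [apply Rmult_le_compat_r; lra|]. right. field. lra. }
    lra. }
  apply le_epsilon in Key. lra.
Qed.

(** The equality case: by rigidity F = k zeta^2 / 2 on the disc of radius
rho = 4 d / 3.  At zeta = s rho with s = 1 or s = -1, chosen so that
Re (k zeta^3) <= 0, the point z has |z|^2 <= (rho^2 + rho^2 / 4) / 4, that is
5 d^2 / 9, and the slope would have modulus 1 there. *)
Theorem normalised_not_extremal d W :
  unimodular_tower d W -> normalised W -> 0 < d ->
  W 3%nat 0%nat 0%C ^ 2 + W 2%nat 1%nat 0%C ^ 2 <> 9 / d ^ 2.
Proof.
intros HW HN Hd HE.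
set (rho := 4 / 3 * d). assert (Hrho : 0 < rho) by (unfold rho; lra).
destruct (lewy_chart d W rho HW HN Hd Hrho) as [inv [f [f1 [f2 [f0 [F0 [E1 HC]]]]]]].
{ intros w Hw. set (r := (3 / 4 * Cmod w + d) / 2).
  assert (P := Cmod_ge_0 w). unfold rho in Hw.
  apply (lewy_onto d W r w HW); [unfold r; lra|].
  intros z Hz. apply Rlt_le_trans with (4 / 3 * r); [unfold r; lra|].
  apply (lewy_circle d W r z HW HN); [unfold r; lra|exact Hz]. }
assert (Ed : Cmod (f1 0%C) = / rho).
{ apply Rsqr_inj; [apply Cmod_ge_0|left; now apply Rinv_0_lt_compat|].
  rewrite Rsqr_pow2, E1, HE. unfold rho, Rsqr. field. lra. }
assert (Hf : forall w, Cmod w < rho -> f w = (f1 0%C * w)%C).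
{ apply (Schwarz_rigidity rho f f1 f2 Hrho); [| |exact f0|exact Ed].
  - intros w Hw. destruct (HC w Hw) as [_ [_ [_ [_ H]]]]. exact H.
  - intros w Hw. destruct (HC w Hw) as [I1 [_ [-> _]]]. left. now apply slope_lt_1 with d. }
set (k := f1 0%C) in *.
assert (HF : forall w, Cmod w < rho -> colewy W (inv w) = (k * RtoC (/ 2) * (w * w))%C).
{ intros w Hw.
  assert (B := primitive_bound rho 0 (fun v => colewy W (inv v) + - k * RtoC (/ 2) * (v * v))%C
    (fun v => f v + - k * RtoC (/ 2) * (1 * v + v * 1))%C).
  cbv beta in B. rewrite F0 in B. specialize (B ltac:(ring)).
  assert (B' : Cmod (colewy W (inv w) + - k * RtoC (/ 2) * (w * w)) <= 0 * Cmod w ^ 2 / 2).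
  { apply B; [| |exact Hw].
    - intros z Hz. apply has_cderiv_plus; [now apply HC|].
      apply has_cderiv_scal. apply has_cderiv_mult; apply has_cderiv_id.
    - intros z Hz. rewrite (Hf z Hz).
      replace (k * z + - k * RtoC (/ 2) * (1 * z + z * 1))%C with (RtoC 0).
      + rewrite Cmod_0. lra.
      + apply injective_projections; simpl; field. }
  assert (P := Cmod_ge_0 (colewy W (inv w) + - k * RtoC (/ 2) * (w * w))).
  replace (colewy W (inv w)) with ((colewy W (inv w) + - k * RtoC (/ 2) * (w * w)) + k * RtoC (/ 2) * (w * w))%C by ring.
  rewrite (Cmod_eq_0 (colewy W (inv w) + - k * RtoC (/ 2) * (w * w))) by lra. ring. }
(* on one of the two radii [0, rho) and (- rho, 0] the cubic [k w^3] has nonpositive real part *)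
assert (Hs : exists s : R, s ^ 2 = 1 /\ s * Re k <= 0).
{ destruct (Rle_dec (Re k) 0); [exists 1|exists (-1)]; lra. }
destruct Hs as [s [Hs Hsk]].
set (w := fun t => RtoC (s * t * rho)).
assert (Habs : Rabs s = 1).
{ assert (X : Rsqr (Rabs s) = Rsqr 1) by (rewrite <- Rsqr_abs, Rsqr_pow2, Hs; unfold Rsqr; ring).
  apply Rsqr_inj in X; [exact X|apply Rabs_pos|lra]. }
assert (Cw : forall t, 0 <= t -> Cmod (w t) = t * rho).
{ intros t Ht. unfold w. rewrite Cmod_R, !Rabs_mult, Habs, (Rabs_pos_eq t), (Rabs_pos_eq rho) by lra. ring. }
set (zeta := fun t : R => ((w t + Cconj (k * RtoC (/ 2) * (w t * w t))) * RtoC (/ 2))%C).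
assert (Ez : forall t, 0 <= t < 1 -> inv (w t) = zeta t /\ Cmod (slope W (zeta t)) = t).
{ intros t Ht. assert (Hw : Cmod (w t) < rho) by (rewrite Cw by lra; nra).
  destruct (HC (w t) Hw) as [_ [I2 [I3 _]]].
  assert (E : inv (w t) = zeta t).
  { rewrite (lewy_colewy W (inv (w t))), I2, (HF _ Hw). reflexivity. }
  split; [exact E|]. rewrite <- E, <- I3, (Hf _ Hw), Cmod_mult, Ed, Cw by lra. field. lra. }
assert (Hz1 : Cmod (zeta 1) < d).
{ apply Rsqr_incrst_0; [|apply Cmod_ge_0|lra]. rewrite !Rsqr_pow2, Cmod2_alt.
  assert (Ek : Re k ^ 2 + Im k ^ 2 = / rho ^ 2) by (rewrite <- Cmod2_alt, Ed; field; lra).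
  replace (Re (zeta 1) ^ 2 + Im (zeta 1) ^ 2) with
    (s ^ 2 * rho ^ 2 / 4 + s ^ 2 * (s * Re k) * rho ^ 3 / 4 + (s ^ 2) ^ 2 * (Re k ^ 2 + Im k ^ 2) * rho ^ 4 / 16)
    by (unfold zeta, w, Re, Im; simpl; field).
  rewrite Hs, Ek. replace (1 ^ 2 * / rho ^ 2 * rho ^ 4 / 16) with (rho ^ 2 / 16) by (field; lra).
  assert (0 < rho ^ 3) by (apply pow_lt; lra).
  assert (s * Re k * rho ^ 3 <= 0) by nra.
  assert (0 < d ^ 2) by (apply pow_lt; lra).
  replace (rho ^ 2) with (16 / 9 * d ^ 2) by (unfold rho; field). lra. }
assert (Hlt := slope_lt_1 d W (zeta 1) HW Hz1).
destruct (slope_chain d W HW) as [h1 [h2 Hh]]. destruct (Hh _ Hz1) as [_ [D _]].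
destruct (has_partials_Lipschitz _ _ _ _ D) as [M [e [HM [He K]]]].
set (gap := 1 - Cmod (slope W (zeta 1))).
(* [zeta t] tends to [zeta 1] along the radius, where the slope has modulus [t] *)
assert (Hzt : forall t, 0 <= t < 1 -> Cmod (zeta t - zeta 1) <= (1 - t) * rho).
{ intros t Ht. 
  assert (E : (zeta t - zeta 1)%C = (RtoC (/ 2) * (RtoC (s * (t - 1) * rho) + Cconj k * RtoC (/ 2 * (s * s * rho * rho * (t * t - 1)))))%C).
  { unfold zeta, w. apply injective_projections; simpl; field. }
  rewrite E, Cmod_mult, Cmod_R, (Rabs_pos_eq (/ 2)) by lra.
  assert (T := Cmod_triangle (RtoC (s * (t - 1) * rho)) (Cconj k * RtoC (/ 2 * (s * s * rho * rho * (t * t - 1))))).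
  rewrite Cmod_mult, Cmod_conj, Ed, !Cmod_R in T.
  rewrite !Rabs_mult, Habs, (Rabs_pos_eq rho), (Rabs_pos_eq (/2)), (Rabs_left (t - 1)), (Rabs_left (t * t - 1)) in T by nra.
  replace (/ rho * (/ 2 * (1 * 1 * rho * rho * - (t * t - 1)))) with ((1 - t) * rho * ((1 + t) / 2)) in T by (field; lra).
  assert ((1 - t) * rho * ((1 + t) / 2) <= (1 - t) * rho).
  { assert (0 < (1 - t) * rho) by (apply Rmult_lt_0_compat; lra). nra. }
  lra. }
set (t := 1 - Rmin (1 / 2) (Rmin (e / (2 * rho)) (gap / (2 * (M * rho + 1))))).
assert (HMr : 0 < M * rho) by now apply Rmult_lt_0_compat.
assert (Hq1 : 0 < e / (2 * rho)) by (apply Rdiv_lt_0_compat; lra).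
assert (Hq2 : 0 < gap / (2 * (M * rho + 1))) by (apply Rdiv_lt_0_compat; unfold gap; lra).
assert (Ht : 0 <= t < 1 /\ 1 - t <= e / (2 * rho) /\ 1 - t <= gap / (2 * (M * rho + 1))).
{ unfold t, Rmin. repeat destruct Rle_dec; lra. }
destruct Ht as [Ht [Ht1 Ht2]]. clearbody t.
specialize (Hzt t Ht).
assert (Hclose : Cmod (zeta t - zeta 1) < e).
{ apply (Rmult_le_compat_r rho) in Ht1; [|lra].
  replace (e / (2 * rho) * rho) with (e / 2) in Ht1 by (field; lra). lra. }
specialize (K _ Hclose). destruct (Ez t Ht) as [_ Es].
assert (T := Cmod_sub_triangle (slope W (zeta t)) (slope W (zeta 1))). rewrite Es in T.
assert (M * Cmod (zeta t - zeta 1) <= M * rho * (1 - t)).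
{ replace (M * rho * (1 - t)) with (M * ((1 - t) * rho)) by ring. apply Rmult_le_compat_l; lra. }
apply (Rmult_le_compat_r (M * rho + 1)) in Ht2; [|lra].
replace (gap / (2 * (M * rho + 1)) * (M * rho + 1)) with (gap / 2) in Ht2 by (field; lra).
assert (0 < gap) by (unfold gap; lra).
unfold gap in *. lra.
Qed.

(** * Iterated partial derivatives of a smooth function *)

Definition iter_partial (u : R * R -> R) (m n : nat) : R * R -> R :=
  Nat.iter m (partial i1) (Nat.iter n (partial i2) u).

Lemma smooth_partial U f i : smooth_on U f -> smooth_on U (partial i f).
Proof.
intros H p n Hp. specialize (H p (S n) Hp).
destruct i; [now apply ex_diff_n_deriv_aux1 in H|now apply ex_diff_n_deriv_aux2 in H].
Qed.

Lemma smooth_iter_partial U u m n : smooth_on U u -> smooth_on U (iter_partial u m n).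
Proof.
intros H. unfold iter_partial. induction m as [|m IH]; simpl; [|now apply smooth_partial].
induction n as [|n IH]; simpl; [exact H|now apply smooth_partial].
Qed.

Lemma partial_ext_on U f g i p :
  open U -> (forall q, U q -> f q = g q) -> U p -> partial i f p = partial i g p.
Proof.
intros HU H Hp. destruct p as [x y].
assert (L : locally_2d (fun a b => U (a, b)) x y).
{ apply locally_2d_locally. generalize (HU _ Hp). apply filter_imp. intros [a b]. auto. }
destruct i; simpl; apply Derive_ext_loc.
- apply locally_2d_1d_const_y in L. revert L. apply filter_imp. auto.
- apply locally_2d_1d_const_x in L. revert L. apply filter_imp. auto.
Qed.

(** Proved on all of [U], not only at a point, so that it can be used under
further derivatives. *)
Lemma smooth_partials_commute U f p :
  open U -> smooth_on U f -> U p ->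
  partial i2 (partial i1 f) p = partial i1 (partial i2 f) p.
Proof.
intros HU Hf Hp. destruct p as [x y]. simpl. symmetry.
apply (Schwarz (fun a b => f (a, b))).
- assert (L := HU _ Hp : locally (x, y) U).
  apply locally_2d_locally. revert L. apply filter_imp. intros [a b] Hq.
  destruct (Hf (a, b) 2%nat Hq) as [_ [E1 [E2 [[_ [_ [E3 _]]] [_ [E4 _]]]]]].
  simpl in *. auto.
- destruct (Hf (x, y) 2%nat Hp) as [_ [_ [_ [_ [_ [_ [_ [[C _] _]]]]]]]]. exact C.
- destruct (Hf (x, y) 2%nat Hp) as [_ [_ [_ [[_ [_ [_ [_ [C _]]]]] _]]]]. exact C.
Qed.

Lemma partial_iter_partial_2 U u m n p :
  open U -> smooth_on U u -> U p -> partial i2 (iter_partial u m n) p = iter_partial u m (S n) p.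
Proof.
intros HU Hu. revert p. induction m as [|m IH]; intros p Hp; [reflexivity|].
change (iter_partial u (S m) n) with (partial i1 (iter_partial u m n)).
rewrite (smooth_partials_commute U) by (auto using smooth_iter_partial).
change (iter_partial u (S m) (S n) p) with (partial i1 (iter_partial u m (S n)) p).
now apply (partial_ext_on U).
Qed.

Lemma has_partials_of_differentiable f x y lx ly :
  differentiable_pt_lim (fun a b => f (a, b)) x y lx ly ->
  has_partials (fun z => RtoC (f z)) ((x, y) : C) (RtoC lx) (RtoC ly).
Proof.
intros H eps Heps. destruct (H (mkposreal eps Heps)) as [d K]. exists d.
split; [apply cond_pos|]. intros [a b] Hw.
assert (L := Rmax_Cmod ((a, b) - (x, y))%C). simpl fst in L; simpl snd in L.
assert (L1 := Rle_lt_trans _ _ _ (Rle_trans _ _ _ (Rmax_l _ _) L) Hw).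
assert (L2 := Rle_lt_trans _ _ _ (Rle_trans _ _ _ (Rmax_r _ _) L) Hw).
specialize (K a b L1 L2). simpl in K.
match goal with |- Cmod ?e <= _ =>
  replace e with (RtoC (f (a, b) - f (x, y) - (lx * (a - x) + ly * (b - y)))) end.
- rewrite Cmod_R. eapply Rle_trans; [exact K|]. apply Rmult_le_compat_l; [lra|exact L].
- apply injective_projections; unfold Re, Im; simpl; ring.
Qed.

Lemma smooth_has_partials U f p :
  open U -> smooth_on U f -> U p ->
  has_partials (fun z => RtoC (f z)) (p : C) (RtoC (partial i1 f p)) (RtoC (partial i2 f p)).
Proof.
intros HU Hf Hp. destruct p as [x y]. apply has_partials_of_differentiable.
apply filterdiff_differentiable_pt_lim.
destruct (Hf (x, y) 1%nat Hp) as [_ [_ [E2 [[C _] _]]]].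
assert (L := HU _ Hp : locally (x, y) U).
refine (filterdiff_ext_lin _ _ _ (is_derive_filterdiff (fun a b => f (a, b)) x y
  (fun a b => partial i1 f (a, b)) (partial i2 f (x, y)) _ _ _) _).
- revert L. apply filter_imp. intros [a b] Hq. apply Derive_correct.
  destruct (Hf (a, b) 1%nat Hq) as [_ [E1 _]]. exact E1.
- apply Derive_correct. exact E2.
- apply (continuity_2d_pt_filterlim (fun a b => partial i1 f (a, b)) x y). exact C.
- intros [a b]. reflexivity.
Qed.

Lemma iter_partial_has_partials U u m n p :
  open U -> smooth_on U u -> U p ->
  has_partials (fun z => RtoC (iter_partial u m n z)) (p : C) (RtoC (iter_partial u (S m) n p)) (RtoC (iter_partial u m (S n) p)).
Proof.
intros HU Hu Hp. rewrite <- (partial_iter_partial_2 U) by assumption.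
apply (smooth_has_partials U); auto using smooth_iter_partial.
Qed.

(** * Triangular changes of coordinates *)

(** The matrix of the change of variables is upper triangular, with columns
[(a, 0)] and [(b, c)]; the inverse of a Cholesky factor has this form. *)
Definition affine (x : R * R) (a b c : R) (z : C) : C :=
  (fst x + a * Re z + b * Im z, snd x + c * Im z).

Lemma affine_Lipschitz x a b c z w :
  Cmod (affine x a b c w - affine x a b c z) <= (Rabs a + Rabs b + Rabs c) * Cmod (w - z).
Proof.
replace (affine x a b c w - affine x a b c z)%C with
  (RtoC a * RtoC (Re (w - z)) + (RtoC b * RtoC (Im (w - z)) + Ci * (RtoC c * RtoC (Im (w - z)))))%C.
- assert (A1 := re_le_Cmod (w - z)). assert (A2 := im_le_Cmod (w - z)).
  assert (Pa := Rabs_pos a). assert (Pb := Rabs_pos b). assert (Pc := Rabs_pos c).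
  eapply Rle_trans; [apply Cmod_triangle|].
  assert (T := Cmod_triangle (RtoC b * RtoC (Im (w - z))) (Ci * (RtoC c * RtoC (Im (w - z))))).
  rewrite !Cmod_mult, Cmod_Ci, !Cmod_R in *.
  assert (B1 := Rmult_le_compat_l _ _ _ Pa A1).
  assert (B2 := Rmult_le_compat_l _ _ _ Pb A2).
  assert (B3 := Rmult_le_compat_l _ _ _ Pc A2). lra.
- unfold affine. apply injective_projections; unfold Re, Im; simpl; ring.
Qed.

Lemma has_partials_affine_comp f x a b c z l m :
  has_partials f (affine x a b c z) l m ->
  has_partials (fun w => f (affine x a b c w)) z (RtoC a * l)%C (RtoC b * l + RtoC c * m)%C.
Proof.
intros H eps Heps. set (k := Rabs a + Rabs b + Rabs c + 1).
assert (Hk : 0 < k).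
{ assert (Pa := Rabs_pos a). assert (Pb := Rabs_pos b). assert (Pc := Rabs_pos c). unfold k. lra. }
destruct (H (eps / k)) as [d [Hd K]]; [now apply Rdiv_lt_0_compat|].
exists (d / k). split; [now apply Rdiv_lt_0_compat|]. intros w Hw.
assert (P := Cmod_ge_0 (w - z)).
assert (L : Cmod (affine x a b c w - affine x a b c z) <= k * Cmod (w - z)).
{ eapply Rle_trans; [apply affine_Lipschitz|]. unfold k. lra. }
assert (Hw' : k * Cmod (w - z) < d).
{ apply (Rmult_lt_compat_l k) in Hw; [|exact Hk]. replace (k * (d / k)) with d in Hw by (field; lra). exact Hw. }
specialize (K (affine x a b c w) ltac:(lra)). cbv beta in K.
match goal with |- Cmod ?e <= _ => match type of K with Cmod ?e' <= _ => replace e with e' end end.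
- eapply Rle_trans; [exact K|].
  apply Rle_trans with (eps / k * (k * Cmod (w - z))).
  + apply Rmult_le_compat_l; [left; now apply Rdiv_lt_0_compat|exact L].
  + right. field. lra.
- replace (RtoC (Re (affine x a b c w - affine x a b c z))) with (RtoC a * RtoC (Re (w - z)) + RtoC b * RtoC (Im (w - z)))%C
    by (apply injective_projections; unfold affine, Re, Im; simpl; ring).
  replace (RtoC (Im (affine x a b c w - affine x a b c z))) with (RtoC c * RtoC (Im (w - z)))%C
    by (apply injective_projections; unfold affine, Re, Im; simpl; ring).
  ring.
Qed.

(** The derivative d_x^m d_y^k (b d_x + c d_y)^n u, where b d_x + c d_y is the
derivative along the second column of the change of variables. *)
Fixpoint skew_partials (u : R * R -> R) (b c : R) (n m k : nat) (p : R * R) : R :=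
  match n with
  | O => iter_partial u m k p
  | S n' => b * skew_partials u b c n' (S m) k p + c * skew_partials u b c n' m (S k) p
  end.

Definition affine_partials (u : R * R -> R) (x : R * R) (a b c : R) (m n : nat) (z : C) : R :=
  a ^ m * skew_partials u b c n m 0 (affine x a b c z).

Lemma skew_partials_has_partials U u b c n m k p :
  open U -> smooth_on U u -> U p ->
  has_partials (fun z => RtoC (skew_partials u b c n m k z)) (p : C)
    (RtoC (skew_partials u b c n (S m) k p)) (RtoC (skew_partials u b c n m (S k) p)).
Proof.
intros HU Hu Hp. revert m k. induction n as [|n IH]; intros m k; simpl.
- now apply (iter_partial_has_partials U).
- assert (H := has_partials_plus _ _ _ _ _ _ _ (has_partials_scal (RtoC b) _ _ _ _ (IH (S m) k))
    (has_partials_scal (RtoC c) _ _ _ _ (IH m (S k)))).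
  rewrite !RtoC_plus, !RtoC_mult. refine (has_partials_ext _ _ _ _ _ _ H).
  intros w. now rewrite RtoC_plus, !RtoC_mult.
Qed.

Lemma affine_partials_has_partials U u x a b c m n z :
  open U -> smooth_on U u -> U (affine x a b c z) ->
  has_partials (fun w => RtoC (affine_partials u x a b c m n w)) z
    (RtoC (affine_partials u x a b c (S m) n z)) (RtoC (affine_partials u x a b c m (S n) z)).
Proof.
intros HU Hu Hz.
assert (H := has_partials_scal (RtoC (a ^ m)) _ _ _ _
  (has_partials_affine_comp _ _ _ _ _ _ _ _ (skew_partials_has_partials U u b c n m 0 _ HU Hu Hz))).
unfold affine_partials. 
match type of H with has_partials _ _ ?v ?w =>
  match goal with |- has_partials _ _ ?v' ?w' =>
    replace v' with v by (simpl; rewrite <- !RtoC_mult; f_equal; ring);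
    replace w' with w by (simpl; rewrite <- !RtoC_mult, <- RtoC_plus, <- RtoC_mult; f_equal; ring) end end.
refine (has_partials_ext _ _ _ _ _ _ H). intros w. now rewrite RtoC_mult.
Qed.

(** * Curvature of a Hessian metric *)

Definition order1 (i : idx) : nat := match i with i1 => 1 | i2 => 0 end.
Definition order2 (i : idx) : nat := match i with i1 => 0 | i2 => 1 end.

Definition third_partial (u : R * R -> R) (i j k : idx) : R * R -> R :=
  iter_partial u (order1 i + order1 j + order1 k) (order2 i + order2 j + order2 k).

Lemma Hess_iter_partial U u i j p :
  open U -> smooth_on U u -> U p ->
  Hess u p i j = iter_partial u (order1 i + order1 j) (order2 i + order2 j) p.
Proof.
intros HU Hu Hp. destruct i, j; try reflexivity.
exact (partial_iter_partial_2 U u 1 0 p HU Hu Hp).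
Qed.

Lemma partial_iter_partial U u i m n p :
  open U -> smooth_on U u -> U p ->
  partial i (iter_partial u m n) p = iter_partial u (order1 i + m) (order2 i + n) p.
Proof. intros HU Hu Hp. destruct i; [reflexivity|now apply (partial_iter_partial_2 U)]. Qed.

Lemma partial_Hess U u i j k p :
  open U -> smooth_on U u -> U p ->
  partial k (fun q => Hess u q i j) p = third_partial u k i j p.
Proof.
intros HU Hu Hp.
rewrite (partial_ext_on U _ (iter_partial u (order1 i + order1 j) (order2 i + order2 j))) by
  (intros; auto; now apply (Hess_iter_partial U)).
rewrite (partial_iter_partial U) by assumption. unfold third_partial. now rewrite !Nat.add_assoc.
Qed.

Definition christoffel_formula (u : R * R -> R) (k i j : idx) (p : R * R) : R :=
  match k with
  | i1 => / 2 * (iter_partial u 0 2 p * third_partial u i j i1 p - iter_partial u 1 1 p * third_partial u i j i2 p)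
  | i2 => / 2 * (iter_partial u 2 0 p * third_partial u i j i2 p - iter_partial u 1 1 p * third_partial u i j i1 p)
  end.

(** For a Hessian metric the derivatives of the coefficients are the symmetric
third derivatives of the potential, so the bracket in the Christoffel symbol
is a single one of them. *)
Lemma christoffel_Hess U u k i j p :
  open U -> smooth_on U u -> (forall q, U q -> det2 (Hess u q) = 1) -> U p ->
  christoffel (Hess u) k i j p = christoffel_formula u k i j p.
Proof.
intros HU Hu Hdet Hp. unfold christoffel, sum2.
rewrite !(partial_Hess U) by assumption.
destruct k; unfold inv2; rewrite (Hdet p Hp), !(Hess_iter_partial U) by assumption;
  destruct i, j; unfold christoffel_formula, third_partial; simpl; field.
Qed.

Lemma partial_bilinear U f1 g1 f2 g2 i p :
  smooth_on U f1 -> smooth_on U g1 -> smooth_on U f2 -> smooth_on U g2 -> U p ->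
  partial i (fun q => / 2 * (f1 q * g1 q - f2 q * g2 q)) p =
  / 2 * (partial i f1 p * g1 p + f1 p * partial i g1 p
         - partial i f2 p * g2 p - f2 p * partial i g2 p).
Proof.
intros H1 H2 H3 H4 Hp. destruct p as [x y].
destruct (H1 _ 1%nat Hp) as [_ [A1 [B1 _]]]. destruct (H2 _ 1%nat Hp) as [_ [A2 [B2 _]]].
destruct (H3 _ 1%nat Hp) as [_ [A3 [B3 _]]]. destruct (H4 _ 1%nat Hp) as [_ [A4 [B4 _]]].
simpl in *.
destruct i; simpl; apply is_derive_unique.
- apply Derive_correct in A1, A2, A3, A4.
  set (F1 := fun t => f1 (t, y)) in *. set (F2 := fun t => g1 (t, y)) in *.
  set (F3 := fun t => f2 (t, y)) in *. set (F4 := fun t => g2 (t, y)) in *.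
  change (f1 (x, y)) with (F1 x). change (g1 (x, y)) with (F2 x).
  change (f2 (x, y)) with (F3 x). change (g2 (x, y)) with (F4 x).
  apply (is_derive_ext (fun t => / 2 * (F1 t * F2 t - F3 t * F4 t))); [reflexivity|].
  auto_derive; [repeat split; eexists; eassumption|].
  change (fun x0 : R => F1 x0) with F1. change (fun x0 : R => F2 x0) with F2.
  change (fun x0 : R => F3 x0) with F3. change (fun x0 : R => F4 x0) with F4. ring.
- apply Derive_correct in B1, B2, B3, B4.
  set (F1 := fun t => f1 (x, t)) in *. set (F2 := fun t => g1 (x, t)) in *.
  set (F3 := fun t => f2 (x, t)) in *. set (F4 := fun t => g2 (x, t)) in *.
  change (f1 (x, y)) with (F1 y). change (g1 (x, y)) with (F2 y).
  change (f2 (x, y)) with (F3 y). change (g2 (x, y)) with (F4 y).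
  apply (is_derive_ext (fun t => / 2 * (F1 t * F2 t - F3 t * F4 t))); [reflexivity|].
  auto_derive; [repeat split; eexists; eassumption|].
  change (fun x0 : R => F1 x0) with F1. change (fun x0 : R => F2 x0) with F2.
  change (fun x0 : R => F3 x0) with F3. change (fun x0 : R => F4 x0) with F4. ring.
Qed.

(** The fourth derivatives are left as derivatives of third ones: they cancel
in the curvature tensor. *)
Definition christoffel_partial_formula (u : R * R -> R) (l k i j : idx) (p : R * R) : R :=
  match k with
  | i1 => / 2 * (third_partial u l i2 i2 p * third_partial u i j i1 p + iter_partial u 0 2 p * partial l (third_partial u i j i1) p
                 - third_partial u l i1 i2 p * third_partial u i j i2 p - iter_partial u 1 1 p * partial l (third_partial u i j i2) p)
  | i2 => / 2 * (third_partial u l i1 i1 p * third_partial u i j i2 p + iter_partial u 2 0 p * partial l (third_partial u i j i2) p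
                 - third_partial u l i1 i2 p * third_partial u i j i1 p - iter_partial u 1 1 p * partial l (third_partial u i j i1) p)
  end.

Lemma partial_christoffel_Hess U u l k i j p :
  open U -> smooth_on U u -> (forall q, U q -> det2 (Hess u q) = 1) -> U p ->
  partial l (christoffel (Hess u) k i j) p = christoffel_partial_formula u l k i j p.
Proof.
intros HU Hu Hdet Hp.
rewrite (partial_ext_on U _ (christoffel_formula u k i j)) by (auto; intros; now apply (christoffel_Hess U)).
destruct k; unfold christoffel_formula, christoffel_partial_formula.
- rewrite (partial_bilinear U) by (assumption || now apply smooth_iter_partial).
  rewrite !(partial_iter_partial U u l _ _ p) by assumption.
  unfold third_partial. destruct l; simpl; ring.
- rewrite (partial_bilinear U) by (assumption || now apply smooth_iter_partial).
  rewrite !(partial_iter_partial U u l _ _ p) by assumption.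
  unfold third_partial. destruct l; simpl; ring.
Qed.

Lemma det_derivative U u i p :
  open U -> smooth_on U u -> (forall q, U q -> det2 (Hess u q) = 1) -> U p ->
  third_partial u i i1 i1 p * iter_partial u 0 2 p + iter_partial u 2 0 p * third_partial u i i2 i2 p - 2 * iter_partial u 1 1 p * third_partial u i i1 i2 p = 0.
Proof.
intros HU Hu Hdet Hp.
assert (E : partial i (fun q => / 2 * (iter_partial u 2 0 q * iter_partial u 0 2 q - iter_partial u 1 1 q * iter_partial u 1 1 q)) p = 0).
{ rewrite (partial_ext_on U _ (fun _ => / 2)); [|exact HU| |exact Hp].
  - destruct i; simpl; apply Derive_const.
  - intros q Hq. specialize (Hdet q Hq). unfold det2 in Hdet.
    rewrite !(Hess_iter_partial U) in Hdet by assumption. cbv [order1 order2 Nat.add] in Hdet. rewrite Hdet. field. }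
rewrite (partial_bilinear U) in E by (assumption || now apply smooth_iter_partial).
rewrite !(partial_iter_partial U) in E by assumption. unfold third_partial. destruct i; cbv [order1 order2 Nat.add] in *; lra.
Qed.

(** The curvature is a quadratic form in the third derivatives.  Differentiating
det Hess(u) = 1 expresses u_12 and u_03 through u_30 and u_21, which leaves a
sum of two squares. *)
Lemma scalar_curvature_Hess U u p :
  open U -> smooth_on U u -> (forall q, U q -> det2 (Hess u q) = 1) -> U p ->
  0 < iter_partial u 2 0 p ->
  scalar_curvature (Hess u) p =
    (iter_partial u 3 0 p ^ 2 + (iter_partial u 2 0 p * iter_partial u 2 1 p - iter_partial u 1 1 p * iter_partial u 3 0 p) ^ 2) / iter_partial u 2 0 p ^ 3.
Proof.
intros HU Hu Hdet Hp Hr.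
assert (E1 := det_derivative U u i1 p HU Hu Hdet Hp).
assert (E2 := det_derivative U u i2 p HU Hu Hdet Hp).
assert (E0 := Hdet p Hp). unfold det2 in E0. rewrite !(Hess_iter_partial U) in E0 by assumption.
unfold scalar_curvature, ricci, riemann, sum2.
unfold inv2; rewrite (Hdet p Hp), !(Hess_iter_partial U) by assumption.
rewrite !(partial_christoffel_Hess U) by assumption.
rewrite !(christoffel_Hess U) by assumption.
unfold christoffel_partial_formula, christoffel_formula, third_partial in *. cbv [order1 order2 Nat.add] in *.
rewrite !(partial_iter_partial U) by assumption. cbv [order1 order2 Nat.add].
set (r := iter_partial u 2 0 p) in *. set (s := iter_partial u 1 1 p) in *. set (t := iter_partial u 0 2 p) in *.
set (a := iter_partial u 3 0 p) in *. set (b := iter_partial u 2 1 p) in *. set (c := iter_partial u 1 2 p) in *. set (e := iter_partial u 0 3 p) in *.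
assert (Et : t = (1 + s * s) / r) by (apply Rmult_eq_reg_l with r; [field_simplify; lra|lra]).
assert (Ec : c = (2 * s * b - a * t) / r) by (apply Rmult_eq_reg_l with r; [field_simplify; lra|lra]).
assert (Ee : e = (2 * s * c - b * t) / r) by (apply Rmult_eq_reg_l with r; [field_simplify; lra|lra]).
clearbody t c e. rewrite Ee, Ec, Et. field. lra.
Qed.

(** * Distance to the boundary *)

(** The point where the segment first leaves the open set is not in it but is
a limit of points that are. *)
Lemma boundary_on_segment (U : R * R -> Prop) (x : R * R) (z : C) a b c :
  open U -> U (affine x a b c 0%C) -> ~ U (affine x a b c z) ->
  exists t, 0 <= t <= 1 /\ boundary U (affine x a b c (RtoC t * z)%C).
Proof.
intros HU H0 Hz.
set (g := fun t : R => affine x a b c (RtoC t * z)%C).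
assert (Hg0 : g 0 = affine x a b c 0%C) by (unfold g; f_equal; ring).
assert (Hg1 : g 1 = affine x a b c z) by (unfold g; f_equal; ring).
set (k := (Rabs a + Rabs b + Rabs c) * Cmod z + 1).
assert (Hk : 0 < k).
{ assert (A := Rabs_pos a). assert (B := Rabs_pos b). assert (B' := Rabs_pos c).
  assert (B'' := Cmod_ge_0 z). unfold k. nra. }
assert (Lip : forall s t, Cmod (g s - g t) <= k * Rabs (s - t)).
{ intros s t. eapply Rle_trans; [apply affine_Lipschitz|].
  replace (RtoC s * z - RtoC t * z)%C with (RtoC (s - t) * z)%C by (rewrite RtoC_minus; ring).
  rewrite Cmod_mult, Cmod_R. assert (P := Rabs_pos (s - t)). unfold k. nra. }
(* the exit time of the segment *)
destruct (completeness (fun t => 0 <= t <= 1 /\ forall s, 0 <= s <= t -> U (g s))) as [t [Hub Hlub]].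
{ exists 1. intros t [Ht _]. lra. }
{ exists 0. split; [lra|]. intros s Hs. replace s with 0 by lra. now rewrite Hg0. }
assert (Ht0 : 0 <= t).
{ apply Hub. split; [lra|]. intros s Hs. replace s with 0 by lra. now rewrite Hg0. }
assert (Ht1 : t <= 1) by (apply Hlub; intros s [Hs _]; lra).
assert (Hbelow : forall s, 0 <= s < t -> U (g s)).
{ intros s Hs. apply NNPP. intros Hn. assert (t <= s); [|lra].
  apply Hlub. intros t' [Ht' Hall]. apply Rnot_lt_le. intros L. apply Hn, Hall. lra. }
assert (Hball : forall P : R * R -> Prop, locally (g t) P -> exists d, 0 < d /\ forall s, Rabs (s - t) < d -> P (g s)).
{ intros P HP. apply (locally_Cmod (g t) P) in HP. destruct HP as [d [Hd K]].
  exists (d / k). split; [now apply Rdiv_lt_0_compat|]. intros s Hs. apply K.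
  eapply Rle_lt_trans; [apply Lip|]. apply (Rmult_lt_compat_l k) in Hs; [|exact Hk].
  replace (k * (d / k)) with d in Hs by (field; lra). exact Hs. }
assert (NU : ~ U (g t)).
{ intros HUt. destruct (Hball U (HU _ HUt)) as [d [Hd K]].
  assert (Hext : forall s, 0 <= s <= Rmin 1 (t + d / 2) -> U (g s)).
  { intros s Hs. assert (s <= t + d / 2) by (eapply Rle_trans; [apply Hs|apply Rmin_r]).
    destruct (Rlt_le_dec s t); [apply Hbelow; lra|]. apply K. rewrite Rabs_pos_eq; lra. }
  assert (L : Rmin 1 (t + d / 2) <= t).
  { apply Hub. split; [|exact Hext]. split; [apply Rmin_glb; lra|apply Rmin_l]. }
  unfold Rmin in *. destruct Rle_dec; [|lra].
  apply Hz. rewrite <- Hg1. apply Hext. lra. }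
assert (Ht0' : 0 < t).
{ destruct (Rle_lt_or_eq_dec 0 t Ht0) as [|E]; [assumption|]. exfalso. apply NU. rewrite <- E, Hg0. exact H0. }
exists t. split; [lra|]. fold (g t). split.
- intros HL. destruct (Hball _ HL) as [d [Hd K]].
  set (s := Rmax 0 (t - d / 2)).
  assert (0 <= s < t /\ t - d / 2 <= s) by (unfold s, Rmax; destruct Rle_dec; lra).
  apply (K s); [rewrite Rabs_left; lra|]. apply Hbelow. lra.
- intros HL. exact (NU (locally_singleton _ _ HL)).
Qed.

Lemma dist_to_le G x (S : R * R -> Prop) p :
  S p -> dist_to G x S <= sqrt (quad_form G (fun i => coord p i - coord x i)).
Proof.
intros Hp. unfold dist_to.
match goal with |- real (Glb_Rbar ?E) <= _ => destruct (Glb_Rbar_correct E) as [Hlb Hglb]; set (l := Glb_Rbar E) in * end.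
specialize (Hlb _ (ex_intro _ p (conj Hp eq_refl))).
assert (H0 : Rbar_le (Finite 0) l).
{ apply Hglb. intros d [q [_ ->]]. apply sqrt_pos. }
destruct l; simpl in *; [exact Hlb|contradiction|contradiction].
Qed.

Lemma dist_to_ge G x (S : R * R -> Prop) k :
  (exists p, S p) ->
  (forall p, S p -> k <= sqrt (quad_form G (fun i => coord p i - coord x i))) -> k <= dist_to G x S.
Proof.
intros [p Hp] H. unfold dist_to.
match goal with |- _ <= real (Glb_Rbar ?E) => destruct (Glb_Rbar_correct E) as [Hlb Hglb]; set (l := Glb_Rbar E) in * end.
specialize (Hlb _ (ex_intro _ p (conj Hp eq_refl))).
assert (H0 : Rbar_le (Finite k) l).
{ apply Hglb. intros d [q [Hq ->]]. now apply H. }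
destruct l; simpl in *; [exact H0|contradiction|contradiction].
Qed.

Theorem theorem1p2 :
  ~ exists (U : R * R -> Prop) (u : R * R -> R) (x : R * R),
      open U /\
      (exists p, U p) /\
      (exists p, ~ U p) /\
      smooth_on U u /\
      (forall p, U p -> pos_def (Hess u p)) /\
      (forall p, U p -> det2 (Hess u p) = 1) /\
      U x /\
      sqrt (scalar_curvature (Hess u) x)
        = 3 / dist_to (Hess u x) x (boundary U).
Proof.
intros [U [u [x [HU [_ [[p0 Hp0] [Hu [Hpos [Hdet [Hx Heq]]]]]]]]]].
assert (HH : forall p, U p -> 0 < iter_partial u 2 0 p /\ iter_partial u 2 0 p * iter_partial u 0 2 p - iter_partial u 1 1 p ^ 2 = 1).
{ intros p Hp. split.
  - destruct (Hpos p Hp) as [_ H].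
    specialize (H (fun i => match i with i1 => 1 | i2 => 0 end)).
    unfold quad_form, sum2 in H. rewrite !(Hess_iter_partial U) in H by assumption. cbv [order1 order2 Nat.add] in H.
    specialize (H (ex_intro _ i1 R1_neq_R0)). lra.
  - specialize (Hdet p Hp). unfold det2 in Hdet. rewrite !(Hess_iter_partial U) in Hdet by assumption.
    cbv [order1 order2 Nat.add] in Hdet. lra. }
destruct (HH x Hx) as [Hr Hdetx].
set (r := iter_partial u 2 0 x) in *. set (s := iter_partial u 1 1 x) in *.
(* columns (a, 0) and (b, c) of the inverse Cholesky factor of the Hessian at [x] *)
set (c := sqrt r). assert (Hc : 0 < c) by now apply sqrt_lt_R0.
assert (Hc2 : c * c = r) by (apply sqrt_sqrt; lra).
set (a := / c). assert (Ha : 0 < a) by now apply Rinv_0_lt_compat.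
assert (Hac : a * c = 1) by (unfold a; field; lra).
set (b := - s * a).
set (T := affine x a b c).
assert (HT0 : T 0%C = x).
{ unfold T, affine. apply injective_projections; simpl; ring. }
assert (Hquad : forall z, quad_form (Hess u x) (fun i => coord (T z) i - coord x i) = Cmod z ^ 2).
{ intros z. unfold quad_form, sum2. rewrite !(Hess_iter_partial U) by assumption. rewrite Cmod2_alt. simpl coord.
  cbv [order1 order2 Nat.add]. fold r s.
  assert (Et : iter_partial u 0 2 x = (1 + s ^ 2) / r) by (apply Rmult_eq_reg_l with r; [field_simplify; lra|lra]).
  rewrite Et. unfold T, affine; simpl fst; simpl snd. unfold b, a. rewrite <- Hc2. field. lra. }
assert (HN : forall z, sqrt (quad_form (Hess u x) (fun i => coord (T z) i - coord x i)) = Cmod z).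
{ intros z. rewrite Hquad, <- Rsqr_pow2. apply sqrt_Rsqr, Cmod_ge_0. }
assert (Hsurj : forall p, exists z, T z = p).
{ intros p. exists ((fst p - fst x - b * ((snd p - snd x) / c)) / a, (snd p - snd x) / c).
  unfold T, affine, Re, Im. apply injective_projections; simpl; field; lra. }
set (d := dist_to (Hess u x) x (boundary U)) in *.
assert (HdU : forall z, Cmod z < d -> U (T z)).
{ intros z Hz. apply NNPP. intros Hn.
  destruct (boundary_on_segment U x z a b c HU) as [t [Ht Hb]]; [fold T; now rewrite HT0|exact Hn|].
  assert (L := dist_to_le (Hess u x) x _ _ Hb). fold T in L. rewrite HN in L. fold d in L.
  rewrite Cmod_mult, Cmod_R, Rabs_pos_eq in L by lra. assert (P := Cmod_ge_0 z). nra. }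
assert (Hd : 0 < d).
{ assert (HL : locally (T 0%C) U) by (rewrite HT0; now apply HU).
  apply (locally_Cmod (T 0%C) U) in HL. destruct HL as [e [He K]].
  set (k := Rabs a + Rabs b + Rabs c + 1).
  assert (Hk : 0 < k).
  { assert (Pa := Rabs_pos a). assert (Pb := Rabs_pos b). assert (Pc := Rabs_pos c). unfold k. lra. }
  apply Rlt_le_trans with (e / k); [now apply Rdiv_lt_0_compat|].
  apply dist_to_ge.
  - destruct (Hsurj p0) as [z Ez].
    destruct (boundary_on_segment U x z a b c HU) as [t [_ Hb]].
    + fold T. now rewrite HT0.
    + fold T. now rewrite Ez.
    + now exists (affine x a b c (RtoC t * z)%C).
  - intros p [_ Hb]. destruct (Hsurj p) as [z Ez]. rewrite <- Ez, HN.
    apply Rnot_lt_le. intros L. apply Hb. apply HU. rewrite <- Ez. apply K.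
    eapply Rle_lt_trans; [apply affine_Lipschitz|]. replace (z - 0)%C with z by ring.
    apply (Rmult_lt_compat_l k) in L; [|exact Hk]. replace (k * (e / k)) with e in L by (field; lra).
    assert (P := Cmod_ge_0 z). unfold k in L. nra. }
set (W := affine_partials u x a b c).
assert (HW : unimodular_tower d W).
{ split.
  - intros m n z Hz. apply (affine_partials_has_partials U); [exact HU|exact Hu|now apply HdU].
  - intros z Hz. destruct (HH _ (HdU z Hz)) as [P Q]. unfold W, affine_partials. fold T.
    set (q := T z) in *. cbv [skew_partials]. split.
    + apply Rmult_lt_0_compat; [|exact P]. nra.
    + transitivity ((a * c) ^ 2 * (iter_partial u 2 0 q * iter_partial u 0 2 q - iter_partial u 1 1 q ^ 2)); [ring|].
      rewrite Hac, Q. ring. }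
assert (Ea : a = / c) by reflexivity. assert (Eb : b = - s * / c) by reflexivity.
assert (HWn : normalised W).
{ unfold normalised, W, affine_partials. fold T. rewrite HT0. cbv [skew_partials]. fold r s.
  assert (Et : iter_partial u 0 2 x = (1 + s ^ 2) / r) by (apply Rmult_eq_reg_l with r; [field_simplify; lra|lra]).
  rewrite Et, Ea, Eb, <- Hc2. split; [|split]; field; lra. }
apply (normalised_not_extremal d W HW HWn Hd).
assert (HR : scalar_curvature (Hess u) x = W 3%nat 0%nat 0%C ^ 2 + W 2%nat 1%nat 0%C ^ 2).
{ rewrite (scalar_curvature_Hess U) by assumption. fold r s.
  unfold W, affine_partials. fold T. rewrite HT0. cbv [skew_partials]. rewrite Ea, Eb, <- Hc2. field. lra. }
rewrite <- HR.
assert (P3 : 0 < 3 / d) by (apply Rdiv_lt_0_compat; lra).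
assert (HR0 : 0 <= scalar_curvature (Hess u) x).
{ apply Rnot_lt_le. intros L. rewrite sqrt_neg_0 in Heq by lra. lra. }
rewrite <- (sqrt_sqrt _ HR0), Heq. field. lra.
Qed.
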